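(* Let $m,n,p\geq 1$ and let $\alpha_1,\ldots,\alpha_p\geq 0$ with $\alpha_1+\cdots+\alpha_p=1$. Let $R^1,\ldots,R^p\in{\mathbb Z}_{\geq 0}^m$ and $C^1,\ldots,C^p\in{\mathbb Z}_{\geq 0}^n$ satisfy $|R^1|=\cdots=|R^p|=|C^1|=\cdots=|C^p|=N$. Let $K=(k_{ij})\in{\mathbb Z}_{\geq 0}^{m\times n}$. Define $$R:=\alpha_1R^1+\cdots+\alpha_pR^p,\qquad C:=\alpha_1C^1+\cdots+\alpha_pC^p,$$ and define vectors $\tilde C^1,\ldots,\tilde C^p,\tilde C$ by $$\tilde c^t_j := \Big(\sum_{i=1}^m k_{ij}\Big) - c^t_j\quad(1\leq t\leq p,\ 1\leq j\leq n),\qquad \tilde c_j := \Big(\sum_{i=1}^m k_{ij}\Big) - c_j = \alpha_1\tilde c^1_j+\cdots+\alpha_p\tilde c^p_j .$$ Assume $c^t_j\leq \sum_{i=1}^m k_{ij}$ for all $t,j$ (so $\tilde C^t\in{\mathbb Z}_{\geq 0}^n$), and assume $R$ and $C$ have integer entries (so $\Omega(R)$ and $\Omega(\tilde C)$ are defined). Then $$\frac{\omega(|K|)\,T_K(R,C)}{\Omega(R)\,\Omega(\tilde C)\,\Omega(K)} \;\geq\; \prod_{t=1}^p \left[\frac{T_K(R^t,C^t)}{\min\{\Omega(R^t)\Omega(\tilde C^t),\ \Omega(K)\}}\right]^{\alpha_t}.$$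
   Context: For a vector or matrix $V$, $|V|$ denotes the sum of its entries; coordinates of a vector named by an uppercase letter are denoted by the corresponding lowercase letter (e.g. $R=(r_1,\ldots,r_m)$, $\tilde C^t=(\tilde c^t_1,\ldots,\tilde c^t_n)$). For an integer $n\geq 0$, $\omega(n):=n^n/n!$ with $0^0=1$. For a vector or matrix $V$ with nonnegative integer entries, $\Omega(V)$ is the sum of $\omega(v)$ over all entries $v$ of $V$. For $R\in{\mathbb Z}_{\geq 0}^m$, $C\in{\mathbb Z}_{\geq 0}^n$ and $K\in{\mathbb Z}_{\geq 0}^{m\times n}$, $T_K(R,C)$ is the number of nonnegative integer $m\times n$ matrices $A=(a_{ij})$ with row sums $\sum_j a_{ij}=r_i$, column sums $\sum_i a_{ij}=c_j$, and $a_{ij}\leq k_{ij}$ for all $i,j$.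
   Formalization: Ω(V) is taken as the product, not the sum, of ω(v) over the entries v of V; with the sum the inequality is false, e.g. m=1, n=2, p=1, K=(0,0), R=(0), C=(0,0) gives 1/4 ≥ 1/2. *)

(* Defs.v *)
From mathcomp Require Import all_boot all_order all_algebra.
From mathcomp Require Import finmap.
From mathcomp Require Import all_classical all_reals all_analysis.

Set Implicit Arguments.
Unset Strict Implicit.
Unset Printing Implicit Defensive.

Import Order.TTheory GRing.Theory Num.Theory.
Local Open Scope classical_set_scope.
Local Open Scope ring_scope.

(* Vectors with nonnegative integer entries are rows of type 'rV[nat]_m, used
   both for row sums and for column sums. *)

Definition entry_sum (m n : nat) (V : 'M[nat]_(m, n)) : nat :=
  (\sum_(i < m) \sum_(j < n) V i j)%N.

Definition omega (F : realType) (k : nat) : F := k%:R ^+ k / k`!%:R.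

(* Omega is multiplicative over the entries: for nonnegative integer vectors U
   and V, the concatenation of U and V has weight Omega U * Omega V.  Replacing
   this product by a sum over the entries would make the inequality fail, for
   instance for K = 0 of size 1 x 2 and p = 1. *)
Definition Omega (F : realType) (m n : nat) (V : 'M[nat]_(m, n)) : F :=
  \prod_(i < m) \prod_(j < n) omega F (V i j).

Definition tables (m n : nat) (K : 'M[nat]_(m, n)) (R : 'rV[nat]_m)
    (C : 'rV[nat]_n) : set 'M[nat]_(m, n) :=
  [set A | [/\ forall i, (\sum_(j < n) A i j)%N = R ord0 i,
               forall j, (\sum_(i < m) A i j)%N = C ord0 j &
               forall i j, (A i j <= K i j)%N]].

Lemma tables_finite (m n : nat) (K : 'M[nat]_(m, n)) (R : 'rV[nat]_m)
    (C : 'rV[nat]_n) : finite_set (tables K R C).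
Proof.
pose f (B : 'M['I_(entry_sum K).+1]_(m, n)) := map_mx (@nat_of_ord _) B.
apply: (@sub_finite_set _ _ (range f)); last exact/finite_image/finite_finset.
move=> A [_ _ AK]; exists (map_mx inord A) => //.
apply/matrixP => i j; rewrite !mxE inordK// ltnS (leq_trans (AK i j))//.
by rewrite /entry_sum (bigD1 i)//= (bigD1 j)//= -addnA leq_addr.
Qed.

(* [fset_set] is the intended finite set by [tables_finite]. *)
Definition ntables (m n : nat) (K : 'M[nat]_(m, n)) (R : 'rV[nat]_m)
    (C : 'rV[nat]_n) : nat :=
  #|` fset_set (tables K R C)|.

Definition colsum (m n : nat) (K : 'M[nat]_(m, n)) : 'rV[nat]_n :=
  \row_j (\sum_(i < m) K i j)%N.

(* The subtraction is truncated; it is meant for C <= colsum K entrywise, a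
   condition that is inherited by convex combinations of such C. *)
Definition slack (m n : nat) (K : 'M[nat]_(m, n)) (C : 'rV[nat]_n) :
    'rV[nat]_n :=
  \row_j (colsum K ord0 j - C ord0 j)%N.

Definition natr_mx (F : realType) (m n : nat) (V : 'M[nat]_(m, n)) :
    'M[F]_(m, n) :=
  map_mx (fun k : nat => k%:R) V.

(* Main.v *)
Require Import Defs.
From HB Require Import structures.
From mathcomp Require Import all_boot all_order all_algebra.
From mathcomp Require Import finmap.
From mathcomp Require Import all_classical all_reals all_analysis measurable_realfun.
From mathcomp Require unstable.
From mathcomp Require Import ring lra zify.

(** Replacing the column sums by the slacks turns [T_K(R,C)] into a coefficient:
  with [V = (R, slack C)] it is the coefficient of [x^V] in the product over
  the cells [e = (i,j)] of [h_k(x_i,y_j)], where [k = k_ij] and [h_k] is the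
  complete homogeneous polynomial.  The beta integral gives
  [h_k(x,y) = (k+1) * \int_0^1 (s x + (1-s) y)^k ds], so [T_K(R,C)] is an
  integral over a cube of coefficients of products of linear forms, that is,
  of permanents.  Such a coefficient is compared with the capacity
  [cap_V(s) = inf_x prod_e (s_e x_i + (1-s_e) y_j)^k_e / x^V]:
  - from above, it is at most [min(1, Omega(V)/Omega(K)) * cap_V(s)], by
    evaluating the polynomial and, for the second bound, by evaluating the
    polynomial of the transposed matrix and using Gibbs' inequality;
  - from below, it is at least [Omega(V)/omega(|K|) * cap_V(s)], which is
    Gurvits' form of the van der Waerden bound; it follows from the
    Alexandrov-Fenchel inequality for permanents.
  For fixed [x] the expression under the infimum is log-concave in [(V,s)], hence
  so is [cap_V(s)]; by Prekopa-Leindler its integral over [s] is log-concave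
  in [V], and [V] is the average of the [V^t]. *)

Set Implicit Arguments.
Unset Strict Implicit.
Unset Printing Implicit Defensive.

Import Order.TTheory GRing.Theory Num.Theory.
Local Open Scope ring_scope.

(** * The Alexandrov-Fenchel inequality for permanents *)

(** For [k >= 2] the polynomial [h_k] has non-real factors, so bounds for products of linear forms
    do not apply to it. Integrating over the mixing parameter repairs this without distorting the
    count: the weight [k! / (a! (k-a)!) * s^a (1-s)^(k-a)] has integral [1/(k+1)] whatever [a] is,
    so every table counts equally and only the constant factor [prod (k+1)] appears. The capacity,
    not the coefficient, carries the averaging: a coefficient exists for integer margins only,
    whereas the capacity is defined for real exponents and is log-concave in exponents and mixing
    parameters jointly, which is what allows the parameters to be integrated out. The technical
    obstacle is vanishing. The Alexandrov-Fenchel argument needs positive columns, but the column of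
    a variable is zero on the cells that do not contain that variable; a shift by [u > 0] and a
    polynomial limit bridge the gap. Functions may also vanish, so log-concavity is stated with
    powers rather than logarithms. *)

Lemma eq_leW (R : numDomainType) (x y : R) : x = y -> x <= y.
Proof. by move->. Qed.

(** * Symmetric forms that are nonpositive on the orthogonal of a positive vector *)

Section Hyperbolic.
Variables (F : realFieldType) (T : finType).

(** A square matrix without kernel is a unit. In [hyperbolic] this takes the place of the spectral
    theorem, so that no eigenvalues have to exist in [F]. *)
Lemma inj_solvable (B : T -> T -> F) :
  (forall y : T -> F, (forall i, \sum_j B i j * y j = 0) -> forall i, y i = 0) ->
  forall y : T -> F, exists z : T -> F, forall i, y i = \sum_j B i j * z j.
Proof.
move=> injB y; pose n := #|T|.
pose M := \matrix_(j < n, i < n) B (enum_val i) (enum_val j).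
have sumE (v : 'rV[F]_n) i :
    (v *m M) ord0 i = \sum_j B (enum_val i) j * v ord0 (enum_rank j).
  rewrite mxE (reindex (@enum_rank T)) /=; last first.
    by exists enum_val => ? _; rewrite ?enum_rankK ?enum_valK.
  by apply: eq_bigr => j _; rewrite mxE enum_rankK mulrC.
have uM : M \in unitmx.
  rewrite -row_free_unit -kermx_eq0; apply/rowV0P => v /sub_kermxP vM.
  apply/rowP => k; rewrite mxE -(enum_valK k).
  apply: (injB (fun j => v ord0 (enum_rank j))) => i.
  by have := sumE v (enum_rank i); rewrite vM mxE enum_rankK => <-.
pose v := (\row_i y (enum_val i)) *m invmx M.
exists (fun j => v ord0 (enum_rank j)) => i.
rewrite -{2}(enum_rankK i) -sumE /v mulmxKV //.
by rewrite mxE enum_rankK.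
Qed.

Variables (M : T -> T -> F) (c : T -> F).
Hypotheses (Msym : forall i j, M i j = M j i) (M_ge0 : forall i j, 0 <= M i j).
Hypothesis c_gt0 : forall i, 0 < c i.

Let app (y : T -> F) i := \sum_j M i j * y j.
Let q (x y : T -> F) := \sum_i x i * app y i.
(** The weight that makes [A] fix [c] at every [i] with [app c i != 0]. On the remaining indices
    [w i = 0] and division by zero gives [A y i = 0]. *)
Let w i := app c i / c i.
Let ip (x y : T -> F) := \sum_i w i * x i * y i.
Let A (y : T -> F) i := app y i / w i.

(** Irreducibility: any two indices outside the zero rows are linked, so that zero energy in
    [laplacian] forces [u / c] to be constant there. *)
Hypothesis M_gt0 :
  forall i j, i != j -> app c i != 0 -> app c j != 0 -> 0 < M i j.
Hypothesis step : forall y, q y y <= \sum_i c i * (app y i ^+ 2 / app c i).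

Let c_neq0 i : c i != 0. Proof. by rewrite gt_eqF. Qed.

Let v_ge0 i : 0 <= app c i.
Proof. by apply: sumr_ge0 => j _; rewrite mulr_ge0 // ltW. Qed.

Let w_ge0 i : 0 <= w i.
Proof. by rewrite divr_ge0 // ltW. Qed.

Let wc i : w i * c i = app c i.
Proof. by rewrite /w divfK. Qed.

Let w_eq0 i : (w i == 0) = (app c i == 0).
Proof. by rewrite mulf_eq0 invr_eq0 (negPf (c_neq0 i)) orbF. Qed.

Let row_eq0 i : app c i = 0 -> forall j, M i j = 0.
Proof.
move=> /eqP; rewrite psumr_eq0 => [/allP vi0 j|j _]; last first.
  by rewrite mulr_ge0 // ltW.
by have := vi0 j (mem_index_enum j); rewrite mulf_eq0 (negPf (c_neq0 j)) orbF => /eqP.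
Qed.

Let wA y i : w i * A y i = app y i.
Proof.
have [w0|w0] := eqVneq (w i) 0; last by rewrite /A mulrC divfK.
rewrite w0 mul0r /app big1 // => j _.
by rewrite row_eq0 ?mul0r //; apply/eqP; rewrite -w_eq0 w0.
Qed.

Let q_sym x y : q x y = q y x.
Proof.
rewrite /q /app; under eq_bigr do rewrite mulr_sumr.
under [RHS]eq_bigr do rewrite mulr_sumr.
by rewrite exchange_big; apply: eq_bigr => i _; apply: eq_bigr => j _;
  rewrite Msym; ring.
Qed.

Let ipA x y : ip x (A y) = q x y.
Proof. by apply: eq_bigr => i _; rewrite -(wA y) mulrAC mulrC. Qed.

Let ip_c y : ip c y = q y c.
Proof. by apply: eq_bigr => i _; rewrite wc mulrC. Qed.

Let ipB x y z : ip x (fun i => y i - z i) = ip x y - ip x z.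
Proof. by rewrite /ip -sumrB; apply: eq_bigr => i _; ring. Qed.

Let ipDZ x y z k : ip x (fun i => y i + k * z i) = ip x y + k * ip x z.
Proof. by rewrite /ip mulr_sumr -big_split; apply: eq_bigr => i _ /=; ring. Qed.

(** Ground-state substitution: since [app c i = w i * c i], the difference of the two forms is the
    Dirichlet form of the quotients [u / c]. *)
Let laplacian u :
  2 * (ip u u - q u u) =
  \sum_i \sum_j M i j * c i * c j * (u i / c i - u j / c j) ^+ 2.
Proof.
have -> : 2 * (ip u u - q u u) =
    \sum_i \sum_j (M i j * c j * (u i ^+ 2 / c i)) +
    \sum_i \sum_j (M i j * c i * (u j ^+ 2 / c j)) -
    \sum_i \sum_j 2 * (M i j * (u i * u j)).
  have -> : \sum_i \sum_j 2 * (M i j * (u i * u j)) = 2 * q u u.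
    rewrite /q mulr_sumr; apply: eq_bigr => i _; rewrite /app !mulr_sumr.
    by apply: eq_bigr => j _; ring.
  rewrite [X in _ + X - _]exchange_big /=.
  have -> : \sum_i \sum_j (M i j * c j * (u i ^+ 2 / c i)) = ip u u.
    apply: eq_bigr => i _; rewrite -mulr_suml -/(app c i) /w; field; exact: c_neq0.
  have -> : \sum_j \sum_i (M i j * c i * (u j ^+ 2 / c j)) = ip u u.
    apply: eq_bigr => i _; rewrite -mulr_suml.
    under eq_bigr do rewrite Msym.
    rewrite -/(app c i) /w; field; exact: c_neq0.
  by ring.
rewrite -big_split -sumrB; apply: eq_bigr => i _.
rewrite -big_split -sumrB; apply: eq_bigr => j _ /=.
by field; rewrite !c_neq0.
Qed.

Let lap_ge0 u i j : 0 <= M i j * c i * c j * (u i / c i - u j / c j) ^+ 2.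
Proof. by rewrite mulr_ge0 ?sqr_ge0 // !mulr_ge0 // ltW. Qed.

Let q_le_ip u : q u u <= ip u u.
Proof.
rewrite -subr_ge0 -(pmulr_rge0 _ (ltr0n _ 2)) laplacian.
by apply: sumr_ge0 => i _; apply: sumr_ge0.
Qed.

(** The rank-one term removes the kernel of [1 - A]. Pairing with [c] kills [y - A y], hence
    [ip c y = 0] and [y = A y]; then [laplacian] makes [y / c] constant outside the zero rows, and
    [ip c y = 0] makes that constant zero. *)
Let injB y : ip c c != 0 ->
  (forall i, y i - A y i + ip c y * c i = 0) -> forall i, y i = 0.
Proof.
move=> cc0 By.
have cA0 : ip c (fun i => y i - A y i) = 0.
  by rewrite ipB ipA ip_c q_sym subrr.
have cy0 : ip c y = 0.
  have : ip c (fun i => y i - A y i + ip c y * c i) = 0.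
    by rewrite /ip big1 // => i _; rewrite By mulr0.
  have -> : ip c (fun i => y i - A y i + ip c y * c i) =
    ip c (fun i => y i - A y i) + ip c y * ip c c.
    by rewrite ipDZ.
  by rewrite cA0 add0r => /eqP; rewrite mulf_eq0 (negPf cc0) orbF => /eqP.
have yA i : y i = A y i.
  by have /eqP := By i; rewrite cy0 mul0r addr0 subr_eq0 => /eqP.
have lap0 : \sum_i \sum_j M i j * c i * c j * (y i / c i - y j / c j) ^+ 2 = 0.
  rewrite -laplacian -ipA.
  have -> : ip y (A y) = ip y y by apply: eq_bigr => i _; rewrite -yA.
  by rewrite subrr mulr0.
move=> i; have [vi0|vi0] := eqVneq (app c i) 0.
  by rewrite yA /A (eqP (_ : w i == 0)) ?invr0 ?mulr0 // w_eq0 vi0.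
have ratio j : app c j != 0 -> y j / c j = y i / c i.
  move=> vj0; have [->//|ij] := eqVneq i j.
  move/eqP: lap0; rewrite psumr_eq0 => [/allP/(_ i (mem_index_enum i))|k _]; last first.
    exact: sumr_ge0.
  rewrite psumr_eq0 => [/allP/(_ j (mem_index_enum j))|//] /=.
  rewrite !mulf_eq0 !(negPf (c_neq0 _)) gt_eqF ?M_gt0 //=.
  by rewrite orbb subr_eq0 => /eqP.
have : ip c y = ip c c * (y i / c i).
  rewrite /ip mulr_suml; apply: eq_bigr => j _; rewrite wc.
  have [->|vj0] := eqVneq (app c j) 0; first by rewrite !mul0r.
  by rewrite -(ratio j vj0); field.
rewrite cy0 => /esym/eqP; rewrite !mulf_eq0 invr_eq0 (negPf cc0) (negPf (c_neq0 i)).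
by rewrite orbF => /eqP.
Qed.

(* [A] is self-adjoint for [ip] and fixes [c].  With [S = 1 - A], the hypothesis
  [step] reads [A S <= 0] and [laplacian] gives [S >= 0] with kernel spanned by
  [c].  So any [y] orthogonal to [c] is [S z] for some [z], and
  [<y, A y> = <z, A S z> - <A z, S A z> <= 0]. *)
Lemma hyperbolic y :
  \sum_i y i * (\sum_j M i j * c j) = 0 ->
  \sum_i y i * (\sum_j M i j * y j) <= 0.
Proof.
rewrite -[_ <= 0]/(q y y <= 0) -[X in X = 0]/(q y c) => yc.
have [cc0|cc0] := eqVneq (ip c c) 0.
  have v0 i : app c i = 0.
    move/eqP: cc0; rewrite psumr_eq0 => [/allP/(_ i (mem_index_enum i))|j _].
      by rewrite wc mulf_eq0 (negPf (c_neq0 i)) orbF => /eqP.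
    by rewrite wc mulr_ge0 // ltW.
  rewrite /q big1 // => i _; rewrite /app big1 ?mulr0 // => j _.
  by rewrite row_eq0 ?mul0r.
pose B i j := (i == j)%:R - M i j / w i + w j * c j * c i.
have BE z i : \sum_j B i j * z j = z i - A z i + ip c z * c i.
  rewrite /B; under eq_bigr do rewrite mulrDl mulrBl.
  rewrite big_split sumrB /=; congr (_ - _ + _).
  - by rewrite (bigD1 i) //= eqxx mul1r big1 ?addr0 // => j /negPf;
      rewrite eq_sym => ->; rewrite mul0r.
  - by rewrite /A /app mulr_suml; apply: eq_bigr => j _; ring.
  - by rewrite /ip mulr_suml; apply: eq_bigr => j _; ring.
have [|z yz] := @inj_solvable B _ y.
  by move=> x xB; apply: injB => // i; rewrite -BE.
have {}yz i : y i = z i - A z i + ip c z * c i by rewrite yz BE.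
have cz0 : ip c z = 0.
  have : ip c y = ip c (fun i => z i - A z i) + ip c z * ip c c.
    by rewrite -ipDZ; apply: eq_bigr => i _; rewrite -yz.
  have -> : ip c y = 0 by rewrite ip_c.
  have cAz : ip c (A z) = ip c z by rewrite ipA ip_c q_sym.
  by rewrite ipB cAz subrr add0r => /esym/eqP; rewrite mulf_eq0 (negPf cc0) orbF => /eqP.
have {}yz i : y i = z i - A z i by rewrite yz cz0 mul0r addr0.
pose u := A z.
have qzu : q z u = ip u u by rewrite q_sym -ipA.
have qyy : q y y = q z z - 2 * q z u + q u u.
  have qBr x : q x y = q x z - q x u.
    rewrite /q -sumrB; apply: eq_bigr => i _.
    rewrite -mulrBr /app -sumrB; congr (_ * _); apply: eq_bigr => j _.
    by rewrite yz mulrBr.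
  by rewrite qBr (q_sym y z) (q_sym y u) !qBr (q_sym u z); ring.
have zz : q z z <= ip u u.
  apply: le_trans (step z) _; apply: ler_sum => i _.
  rewrite /u wA /A /w.
  have [->|v0] := eqVneq (app c i) 0; first by rewrite invr0 !(mul0r,invr0,mulr0).
  by apply: eq_leW; field; rewrite c_neq0.
by have := q_le_ip u; rewrite qyy qzu; lra.
Qed.

End Hyperbolic.

(** * Mixed permanents with repeated rows *)

Section MixedPermanent.
Variables (F : realFieldType) (T : finType).
Implicit Types (K : {ffun T -> nat}) (a b c : {ffun T -> F}).
Implicit Types (s C : seq {ffun T -> F}).

Definition decr K e : {ffun T -> nat} := [ffun f => (K f - (f == e))%N].

(* The permanent of the matrix whose columns are [s] and in which the row of
  index [e] is repeated [K e] times, divided by the product of the [(K e)`!]. *)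
Fixpoint mper s K : F :=
  if s is c :: s' then \sum_(e | (0 < K e)%N) c e * mper s' (decr K e)
  else (K == [ffun=> 0%N])%:R.

Lemma decrC K e f : decr (decr K e) f = decr (decr K f) e.
Proof. by apply/ffunP => g; rewrite !ffunE subnAC. Qed.

Lemma decr_gt0C K e f :
  (0 < K e)%N && (0 < decr K e f)%N = (0 < K f)%N && (0 < decr K f e)%N.
Proof.
rewrite !ffunE (eq_sym e); have [->//|_] := eqVneq f e.
by rewrite !subn0 andbC.
Qed.

Lemma sum_decr K e : (0 < K e)%N -> (\sum_f K f = (\sum_f decr K e f).+1)%N.
Proof.
move=> Ke; rewrite (bigD1 e) //= [in RHS](bigD1 e) //= ffunE eqxx subn1 -addSn prednK //.
by congr addn; apply: eq_bigr => f /negPf fe; rewrite ffunE fe subn0.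
Qed.

Lemma sum_gt0 K n : (\sum_e K e = n.+1)%N -> exists e, (0 < K e)%N.
Proof.
move=> Kn; apply/existsP; apply: contra_eqT Kn; rewrite negb_exists => /forallP K0.
by rewrite big1 // => e _; apply/eqP; rewrite -leqn0 leqNgt.
Qed.

Lemma mper_swap a b s K : mper [:: a, b & s] K = mper [:: b, a & s] K.
Proof.
rewrite /=; under eq_bigr do rewrite mulr_sumr.
under [RHS]eq_bigr do rewrite mulr_sumr.
rewrite (exchange_big_dep (fun f => (0 < K f)%N)) /=; last first.
  by move=> e f Ke Kef; move: (decr_gt0C K e f); rewrite Ke Kef => /esym/andP[].
apply: eq_bigr => f Kf; apply: eq_big => [e|e _]; first by rewrite decr_gt0C Kf.
by rewrite decrC mulrCA.
Qed.

Lemma eq_mper_cons a s t : mper s =1 mper t -> mper (a :: s) =1 mper (a :: t).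
Proof. by move=> st K /=; apply: eq_bigr => e _; rewrite st. Qed.

Lemma mper_mid s a t : mper (s ++ a :: t) =1 mper (a :: s ++ t).
Proof.
elim: s => [//|b s IH] K; rewrite cat_cons (eq_mper_cons b IH).
exact: mper_swap.
Qed.

Lemma mper_perm s t : perm_eq s t -> mper s =1 mper t.
Proof.
elim: s t => [|a s IH] t st; first by move: st; rewrite perm_sym => /perm_nilP ->.
have at_ : a \in t by rewrite -(perm_mem st) mem_head.
case/splitPr: at_ st => t1 t2 st K; rewrite mper_mid; apply: eq_mper_cons.
by apply: IH; rewrite -(perm_cons a) (perm_trans st) // -[a :: t2]cat1s perm_catCA perm_refl.
Qed.

Lemma mper_lin k a b s K :
  mper ([ffun e => k * a e + b e] :: s) K =
  k * mper (a :: s) K + mper (b :: s) K.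
Proof.
rewrite /= mulr_sumr -big_split; apply: eq_bigr => e _ /=.
by rewrite ffunE; ring.
Qed.

Definition pos_col c := [forall e, 0 < c e].

Lemma mper_gt0 s K : all pos_col s -> (\sum_e K e = size s)%N -> 0 < mper s K.
Proof.
elim: s K => [|c s IH] K /=.
  move=> _ /eqP; rewrite sum_nat_eq0 => /forallP K0.
  rewrite (_ : K == _) ?ltr01 //; apply/eqP/ffunP => e; rewrite ffunE.
  by apply/eqP; exact: K0.
move=> /andP[/forallP c0 s0] Ks.
have [e Ke] : exists e, (0 < K e)%N. by exact: (sum_gt0 Ks).
have s_ge0 f : (0 < K f)%N -> 0 < c f * mper s (decr K f).
  move=> Kf; rewrite mulr_gt0 // IH //.
  by apply/eqP; rewrite -eqSS -sum_decr // Ks.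
rewrite (bigD1 e) //= ltr_pwDl ?s_ge0 //.
by apply: sumr_ge0 => f /andP[Kf _]; rewrite ltW // s_ge0.
Qed.

(** Here [K] selects two rows [e] and [f]. If they coincide both sides are equal; otherwise the gap
    is the square of a 2 by 2 determinant. *)
Lemma mper2_sqr a b K : (\sum_e K e = 2)%N ->
  mper [:: a; a] K * mper [:: b; b] K <= mper [:: a; b] K ^+ 2.
Proof.
move=> K2.
have [e Ke] : exists e, (0 < K e)%N. by exact: (sum_gt0 K2).
have K1 : (\sum_f decr K e f = 1)%N by move: K2; rewrite (sum_decr Ke) => -[].
have [f Kf] : exists f, (0 < decr K e f)%N. by exact: (sum_gt0 K1).
have K0 : decr (decr K e) f = [ffun=> 0%N].
  move: K1; rewrite (sum_decr Kf) => -[] /eqP; rewrite sum_nat_eq0 => /forallP K0.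
  by apply/ffunP => g; rewrite (eqP (implyP (K0 g) isT)) ffunE.
have KE g : K g = ((g == e) + (g == f))%N.
  have := congr1 (fun h : {ffun T -> nat} => h g) K0; move: Kf; rewrite !ffunE.
  have [ge|ge] := eqVneq g e; have [gf|gf] := eqVneq g f => /=.
  - by rewrite -gf -ge eqxx /=; lia.
  - by move: Ke; rewrite -ge; lia.
  - by rewrite -gf (negPf ge) /=; lia.
  - by lia.
have mE x y : mper [:: x; y] K = if e == f then x e * y e else x e * y f + x f * y e.
  have term x0 g h : (0 < K g)%N -> (0 < decr K g h)%N ->
      x0 h * mper [::] (decr (decr K g) h) = x0 h.
    move=> Kg Kh /=; rewrite (_ : decr _ h == _) ?mulr1 //; apply/eqP/ffunP => k.
    have : (\sum_e0 decr (decr K g) h e0 = 0)%N.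
      by move: K2; rewrite (sum_decr Kg) (sum_decr Kh) => -[].
    by move/eqP; rewrite sum_nat_eq0 => /forallP/(_ k)/implyP/(_ isT)/eqP->; rewrite ffunE.
  transitivity (\sum_(g | (0 < K g)%N) \sum_(h | (0 < decr K g h)%N) x g * y h).
    apply: eq_bigr => g Kg; rewrite [LHS]/= mulr_sumr; apply: eq_bigr => h Kh.
    by congr (_ * _); exact: term.
  have [ef|ef] := eqVneq e f.
    rewrite (big_pred1 e) => [|g]; last by rewrite KE -ef /=; case: (g == e).
    by rewrite (big_pred1 e) // => g; rewrite ffunE KE -ef /=; case: (g == e).
  rewrite (bigD1 e) //= (big_pred1 f) => [|g]; last first.
    rewrite ffunE KE /=; have [->|] := eqVneq g e; first by rewrite (negPf ef).
    by rewrite add0n subn0; case: (g == f).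
  congr (_ + _); rewrite (big_pred1 f) => [|g]; last first.
    rewrite KE /=; have [->|] := eqVneq g e; first by rewrite andbF (negPf ef).
    by rewrite add0n andbT; case: (g == f).
  rewrite (big_pred1 e) // => g.
  rewrite ffunE KE /=; have [->|] := eqVneq g f; first by rewrite [f == e]eq_sym (negPf ef).
  by rewrite addn0 subn0; case: (g == e).
rewrite !mE; case: ifP => _; first by apply: eq_leW; ring.
rewrite -subr_ge0.
rewrite (_ : _ - _ = (a e * b f - a f * b e) ^+ 2) ?sqr_ge0 //; ring.
Qed.

(* Expanding along a row turns the induction hypothesis into the hypothesis
  [step] of [hyperbolic] (the argument of Shenfeld and van Handel). *)
Theorem mper_AF C a b K :
  all pos_col C -> pos_col b -> (\sum_e K e = (size C).+2)%N ->
  mper [:: a, a & C] K * mper [:: b, b & C] K <= mper [:: a, b & C] K ^+ 2.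
Proof.
elim: C a b K => [|c C IH] a b K; first by move=> _ _; exact: mper2_sqr.
move=> /= /andP[c0 C0] b0 Ksum.
pose Q x y := mper [:: x, y, c & C] K.
change (Q a a * Q b b <= Q a b ^+ 2).
have Qsym x y : Q x y = Q y x by exact: mper_swap.
pose M i j : F := if (0 < K i)%N && (0 < decr K i j)%N
  then mper (c :: C) (decr (decr K i) j) else 0.
have cC0 : all pos_col (c :: C) by rewrite /= c0.
have sumK2 i j : (0 < K i)%N -> (0 < decr K i j)%N ->
    (\sum_e decr (decr K i) j e = (size C).+1)%N.
  by move=> Ki Kj; move: Ksum; rewrite (sum_decr Ki) (sum_decr Kj) => -[].
have ME (y : {ffun T -> F}) i : \sum_j M i j * y j =
    if (0 < K i)%N then mper [:: y, c & C] (decr K i) else 0.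
  rewrite /M; case: ifP => Ki /=; last by rewrite big1 // => j _; rewrite mul0r.
  by rewrite [RHS]big_mkcond; apply: eq_bigr => j _; case: ifP;
    rewrite ?mul0r // mulrC.
have QE (x y : {ffun T -> F}) : Q x y = \sum_i x i * (\sum_j M i j * y j).
  rewrite /Q /= big_mkcond; apply: eq_bigr => i _; rewrite ME.
  by case: ifP => //; rewrite mulr0.
have hyp (y : {ffun T -> F}) : Q y c = 0 -> Q y y <= 0.
  rewrite !QE; apply: hyperbolic => [i j|i j|i|i j ij|z].
  - by rewrite /M decr_gt0C decrC.
  - by rewrite /M; case: ifP => // /andP[Ki Kj]; rewrite ltW // mper_gt0 // sumK2.
  - exact: (forallP c0).
  - rewrite !ME; case: ifP => [Ki _|]; last by rewrite eqxx.
    case: ifP => [Kj _|]; last by rewrite eqxx.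
    have Kij : (0 < decr K i j)%N by rewrite ffunE eq_sym (negPf ij) subn0.
    by rewrite /M Ki Kij mper_gt0 // sumK2.
  - pose z' : {ffun T -> F} := [ffun i => z i].
    have zE i : \sum_j M i j * z j = \sum_j M i j * z' j.
      by apply: eq_bigr => j _; rewrite ffunE.
    have -> : \sum_i z i * (\sum_j M i j * z j) = Q z' z'.
      by rewrite QE; apply: eq_bigr => i _; rewrite zE ffunE.
    have -> : Q z' z' = mper [:: c, z', z' & C] K.
      by apply: (mper_perm (s := [:: z', z', c & C])); rewrite
        -/([:: z'; z'] ++ [:: c] ++ C) perm_catCA perm_refl.
    rewrite /= big_mkcond; apply: ler_sum => i _; rewrite zE !ME.
    case: ifP => Ki; last by rewrite expr0n mul0r mulr0.
    rewrite ler_wpM2l ?(ltW (forallP c0 i)) //.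
    have Kisum : (\sum_e decr K i e = (size C).+2)%N.
      by move: Ksum; rewrite (sum_decr Ki) => -[].
    rewrite ler_pdivlMr; last by rewrite mper_gt0 //= ?c0 // Kisum.
    exact: IH.
have Qlin (x y z : {ffun T -> F}) k : Q [ffun e => k * x e + y e] z = k * Q x z + Q y z.
  exact: mper_lin.
have Qbc : 0 < Q b c by apply: mper_gt0 => //=; rewrite ?b0 ?c0 // Ksum.
have Qbb : 0 < Q b b by apply: mper_gt0 => //=; rewrite ?b0 ?c0 // Ksum.
(* This [t] makes [y = a - t b] orthogonal to [c], so [Q y y <= 0]: a quadratic polynomial in [t]
   with leading coefficient [Q b b > 0] takes a nonpositive value, and its discriminant is therefore
   nonnegative. *)
pose t := Q a c / Q b c.
pose y : {ffun T -> F} := [ffun e => (- t) * b e + a e].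
have := hyp y; rewrite {1}/y Qlin /t.
rewrite mulNr divfK ?gt_eqF // addNr => /(_ erefl).
rewrite {1}/y Qlin (Qsym b y) (Qsym a y) /y !Qlin (Qsym b a) -/t => disc.
have sq : 0 <= (Q a b - t * Q b b) ^+ 2 by exact: sqr_ge0.
have disc2 : (t ^+ 2 * Q b b - 2 * t * Q a b + Q a a) * Q b b <= 0.
  by rewrite pmulr_lle0 //; move: disc; lra.
rewrite -subr_le0.
rewrite (_ : _ - _ =
  (t ^+ 2 * Q b b - 2 * t * Q a b + Q a a) * Q b b - (Q a b - t * Q b b) ^+ 2);
  last by ring.
 by lra.
Qed.

End MixedPermanent.

(** * The capacity bound for products of linear forms *)

Section Sequences.
Variable F : realFieldType.

(** The bound [p.[u] <= p.[0] + u * M] for [0 < u <= 1] replaces continuity, so limits can be taken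
    in any [realFieldType]. *)
Lemma poly_ge0_right (p : {poly F}) : (forall u, 0 < u -> 0 <= p.[u]) -> 0 <= p.[0].
Proof.
move=> p_ge0; pose M := \sum_(i < size p) `|p`_i|.
have M0 : 0 <= M by apply: sumr_ge0 => i _; exact: normr_ge0.
have bound u : 0 < u -> u <= 1 -> p.[u] <= p.[0] + u * M.
  move=> u0 u1; rewrite !horner_coef /M mulr_sumr -big_split.
  apply: ler_sum => -[[|i] ilt] _ /=.
    by rewrite !expr0 lerDl mulr_ge0 // ltW.
  rewrite expr0n /= mulr0 add0r (le_trans (ler_norm _)) // normrM mulrC.
  rewrite ler_wpM2r // normrX gtr0_norm // exprS -[leRHS]mulr1.
  by rewrite ler_wpM2l ?(ltW u0) // exprn_ile1 ?(ltW u0).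
rewrite leNgt; apply/negP => p0.
(* Chosen so that both [u <= 1] and [u * M <= - p.[0] / 2], which would make [p.[u]] negative. *)
pose u := - p.[0] / (2 * (M + 1 - p.[0])).
have D0 : 0 < 2 * (M + 1 - p.[0]) by lra.
have u0 : 0 < u by rewrite divr_gt0 // oppr_gt0.
have u1 : u <= 1 by rewrite ler_pdivrMr // mul1r; lra.
have := le_trans (p_ge0 _ u0) (bound _ u0 u1).
have uM : u * M <= - p.[0] / 2.
  rewrite /u mulrAC ler_pdivrMr //; nra.
by lra.
Qed.

Lemma le_lim1D (c b : F) d : (forall u, 0 < u -> c <= b * (1 + u) ^+ d) -> c <= b.
Proof.
move=> cb; have := @poly_ge0_right (b%:P * (1 + 'X) ^+ d - c%:P).
rewrite !hornerE expr1n mulr1 subr_ge0; apply=> u u0.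
by rewrite !hornerE subr_ge0 cb.
Qed.

(** The quotient [(1 + u)^d / u^v] is minimal at [u = v / (d - v)]. For [v = 0] and [v = d] the
    infimum is only approached, as [u] tends to zero or to infinity, and [le_lim1D] takes over. *)
Lemma le_binomial_cap (c b : F) d v : (v <= d)%N ->
  (forall u, 0 < u -> c * u ^+ v <= b * (1 + u) ^+ d) ->
  c * (v%:R ^+ v * (d - v)%:R ^+ (d - v)) <= b * d%:R ^+ d.
Proof.
move=> + cb; rewrite leq_eqVlt => /predU1P[vd|vd].
  rewrite vd subnn expr0 mulr1 ler_wpM2r ?exprn_ge0 //.
  apply: (@le_lim1D _ _ d) => u u0; have := cb u^-1; rewrite invr_gt0 => /(_ u0).
  have -> : 1 + u^-1 = (1 + u) / u by field; rewrite gt_eqF.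
  by rewrite expr_div_n vd exprVn mulrA ler_pM2r // invr_gt0 exprn_gt0.
have [v0|v0] := posnP v.
  move: cb; rewrite v0 expr0 mul1r subn0 => cb; rewrite ler_wpM2r ?exprn_ge0 //.
  by apply: (@le_lim1D _ _ d) => u /cb; rewrite expr0 mulr1.
have dv0 : 0 < (d - v)%:R :> F by rewrite ltr0n subn_gt0.
have /cb : 0 < v%:R / (d - v)%:R :> F by rewrite divr_gt0 // ltr0n.
have -> : 1 + v%:R / (d - v)%:R = d%:R / (d - v)%:R :> F.
  by rewrite -{2}(subnK (ltnW vd)) natrD; field; rewrite gt_eqF.
have D0 k : 0 < (d - v)%:R ^+ k :> F by rewrite exprn_gt0.
rewrite !expr_div_n => le_cb.
have DE : (d - v)%:R ^+ d = (d - v)%:R ^+ (d - v) * (d - v)%:R ^+ v :> F.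
  by rewrite -exprD subnK // ltnW.
rewrite -(ler_pM2r (D0 d)) in le_cb; apply: le_trans (le_trans le_cb _);
  apply: eq_leW.
  by rewrite DE; field; rewrite expf_neq0 // gt_eqF.
by field; rewrite expf_neq0 // gt_eqF.
Qed.

(* [r] is the slope of a supporting line of [ln b] at [v]. *)
Lemma logconcave_tangent (b : nat -> F) d v : (v <= d)%N ->
  (forall k, (k <= d)%N -> 0 < b k) ->
  (forall k, (k.+2 <= d)%N -> b k * b k.+2 <= b k.+1 ^+ 2) ->
  exists2 r, 0 < r & forall k, (k <= d)%N -> b k * r ^+ v <= b v * r ^+ k.
Proof.
move=> vd b0 blc; pose q i := b i.+1 / b i.
have q0 i : (i < d)%N -> 0 < q i.
  by move=> id; rewrite divr_gt0 ?b0 // ltnW.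
have qmono i j : (i + j < d)%N -> q (i + j)%N <= q i.
  elim: j => [|j IH] ijd; first by rewrite addn0.
  rewrite addnS in ijd *; apply: le_trans (IH (ltnW ijd)).
  rewrite /q ler_pdivrMr ?b0 ?(ltnW ijd) // mulrAC ler_pdivlMr; last first.
    by rewrite b0 // ltnW // ltnW.
  by rewrite mulrC -expr2 blc.
have [r r0 [rhi rlo]] : exists2 r, 0 < r &
    (forall i, (v <= i < d)%N -> q i <= r) /\ (forall i, (i < v)%N -> r <= q i).
  have [vltd|dlev] := ltnP v d.
    exists (q v); first exact: q0.
    split=> [i /andP[vi id]|i iv].
      by have := @qmono v (i - v)%N; rewrite subnKC //; apply.
    by have := @qmono i (v - i)%N; rewrite subnKC //; [apply | exact: ltnW].
  have [v0|v0] := posnP v.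
    by exists 1 => //; split=> i; lia.
  exists (q v.-1); first by rewrite q0; lia.
  split=> i iv; first by lia.
  by have := @qmono i (v.-1 - i)%N; rewrite subnKC; [apply; lia | lia].
exists r => //.
have hi j : (v + j <= d)%N -> b (v + j)%N <= b v * r ^+ j.
  elim: j => [|j IH] vjd; first by rewrite addn0 expr0 mulr1.
  rewrite addnS in vjd *; rewrite exprSr mulrA.
  have /rhi : (v <= v + j < d)%N by lia.
  rewrite ler_pdivrMr ?b0 ?(ltnW vjd) // => /le_trans-> //.
  by rewrite mulrC ler_wpM2r ?(ltW r0) // IH // ltnW.
have lo j : (j <= v)%N -> b (v - j)%N * r ^+ j <= b v.
  elim: j => [|j IH] jv; first by rewrite subn0 expr0 mulr1.
  apply: le_trans (IH (ltnW jv)); rewrite exprS mulrA.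
  rewrite ler_wpM2r ?exprn_ge0 ?(ltW r0) //.
  have /rlo : (v - j.+1 < v)%N by lia.
  rewrite ler_pdivlMr ?b0 /q -?subSn // ?subSS; last by lia.
  by rewrite mulrC.
move=> k kd; have [vk|/ltnW kv] := leqP v k.
  rewrite -{2}(subnKC vk) exprD mulrA [b v * _]mulrC -mulrA mulrC.
  by rewrite ler_wpM2l ?exprn_ge0 ?(ltW r0) // -{1}(subnKC vk) hi ?subnKC.
rewrite -(subnK kv) exprD mulrA ler_wpM2r ?exprn_ge0 ?(ltW r0) // subnK //.
by rewrite -{1}(subKn kv) lo ?leq_subr.
Qed.

End Sequences.

Section Gurvits.
Variables (F : realFieldType) (T : finType).
Implicit Types (K : {ffun T -> nat}) (a b c : {ffun T -> F}).

Lemma pos_nseq n a : pos_col a -> all (@pos_col F T) (nseq n a).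
Proof. by move=> a0; rewrite all_nseq a0 orbT. Qed.

(** The numbers [beta k] are log-concave by [mper_AF], so they lie below a geometric sequence that
    touches them at [v]. The polynomial in [t] is thus dominated by a multiple of [(1 + r t)^d], for
    which [le_binomial_cap] gives the exact loss. *)
Lemma gurvits_step (pre : seq {ffun T -> F}) a b d v (c : F) K :
  all (@pos_col F T) pre -> pos_col a -> pos_col b -> (v <= d)%N ->
  (\sum_e K e = size pre + d)%N ->
  (forall t, 0 < t ->
     c * t ^+ v <= mper (nseq d [ffun e => t * a e + b e] ++ pre) K) ->
  c * (v%:R ^+ v * (d - v)%:R ^+ (d - v)) <=
    mper (nseq v a ++ nseq (d - v) b ++ pre) K * d%:R ^+ d.
Proof.
move=> pre0 a0 b0 vd Ksum cP.
pose beta k := mper (nseq k a ++ nseq (d - k) b ++ pre) K.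
have [r r0 rP] : exists2 r, 0 < r &
    forall k, (k <= d)%N -> beta k * r ^+ v <= beta v * r ^+ k.
  apply: logconcave_tangent => // k kd.
    rewrite mper_gt0 // ?all_cat ?pos_nseq // !size_cat !size_nseq Ksum.
    by rewrite addnA subnKC // addnC.
  pose C := nseq k a ++ nseq (d - k.+2) b ++ pre.
  have dk : (d - k = (d - k.+2).+2)%N by lia.
  have dk1 : (d - k.+1 = (d - k.+2).+1)%N by lia.
  have -> : beta k = mper [:: b, b & C] K.
    pose C' := nseq (d - k.+2) b ++ pre.
    have -> : beta k = mper (nseq k a ++ b :: b :: C') K by rewrite /beta dk.
    by rewrite mper_mid; apply: eq_mper_cons => ?; exact: mper_mid.
  have -> : beta k.+2 = mper [:: a, a & C] K by [].
  have -> : beta k.+1 = mper [:: a, b & C] K.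
    pose C' := nseq (d - k.+2) b ++ pre.
    have -> : beta k.+1 = mper (a :: (nseq k a ++ b :: C')) K by rewrite /beta dk1.
    by apply: eq_mper_cons => ?; exact: mper_mid.
  rewrite mulrC; apply: mper_AF => //.
    by rewrite !all_cat !pos_nseq.
  by rewrite Ksum !size_cat !size_nseq; lia.
(* Splitting one copy of [t a + b] at a time by linearity plays the part of the binomial theorem.
   The case [j = d], [k = 0] is the one used. *)
have bound t j k : 0 < t -> (j + k <= d)%N ->
    mper (nseq j [ffun e => t * a e + b e] ++ nseq k a ++ nseq (d - j - k) b ++ pre) K
      * r ^+ v <= beta v * r ^+ k * (1 + r * t) ^+ j.
  move=> t0; elim: j k => [|j IH] k jkd.
    by rewrite subn0 mulr1; exact: rP.
  set X := finfun _ in IH *; pose R := nseq k a ++ nseq (d - j.+1 - k) b ++ pre.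
  have IH1 : mper (nseq j X ++ a :: R) K * r ^+ v <= beta v * r ^+ k.+1 * (1 + r * t) ^+ j.
    have := IH k.+1; rewrite addnS -addSn => /(_ jkd).
    by rewrite (_ : d - j - k.+1 = d - j.+1 - k)%N //; lia.
  have midE : mper (nseq j X ++ nseq k a ++ nseq (d - j.+1 - k).+1 b ++ pre) K =
      mper (b :: (nseq j X ++ R)) K.
    rewrite /R !(catA (nseq j X) (nseq k a)).
    exact: (mper_mid (nseq j X ++ nseq k a) b (nseq (d - j.+1 - k) b ++ pre)).
  have IH2 : mper (b :: (nseq j X ++ R)) K * r ^+ v <= beta v * r ^+ k * (1 + r * t) ^+ j.
    have := IH k (ltnW jkd); rewrite (_ : d - j - k = (d - j.+1 - k).+1)%N; last by lia.
    by rewrite midE.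
  change (mper (X :: (nseq j X ++ R)) K * r ^+ v <= beta v * r ^+ k * (1 + r * t) ^+ j.+1).
  rewrite {1}/X mper_lin -(mper_mid (nseq j X) a R).
  rewrite exprS mulrDl -mulrA.
  rewrite (_ : _ * (_ * (1 + r * t) ^+ j) =
    t * (beta v * r ^+ k.+1 * (1 + r * t) ^+ j) + beta v * r ^+ k * (1 + r * t) ^+ j);
    last by rewrite [r ^+ k.+1]exprS; ring.
  by rewrite lerD // ler_wpM2l // ltW.
apply: le_binomial_cap => // u u0.
have t0 : 0 < u / r by rewrite divr_gt0.
have := bound (u / r) d 0%N t0; rewrite addn0 => /(_ (leqnn _)).
rewrite subnn sub0n /= expr0 mulr1 mulrCA divff ?gt_eqF // mulr1.
apply: le_trans; have := cP _ t0.
rewrite expr_div_n -(ler_pM2r (exprn_gt0 v r0)); congr (_ <= _).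
by field; rewrite expf_neq0 // gt_eqF.
Qed.

Variables (L : eqType) (a : L -> {ffun T -> F}) (V : L -> nat).

Definition rep_cols (ls : seq L) := flatten [seq nseq (V l) (a l) | l <- ls].

Lemma natX_gt0 n : 0 < n%:R ^+ n :> F.
Proof. by case: n => [|n]; rewrite ?expr0 // exprn_gt0 // ltr0n. Qed.

(** Variables are eliminated one by one, and the columns extracted so far are stored in [pre]. With
    [d] the degree left, a step costs the factor [(V l)^(V l) * d^d / (V l + d)^(V l + d)], and
    these factors telescope. *)
Lemma gurvits (a_gt0 : forall l, pos_col (a l)) ls pre (c : F) K :
  uniq ls -> all (@pos_col F T) pre ->
  (\sum_e K e = size pre + \sum_(l <- ls) V l)%N ->
  (forall x : L -> F, (forall l, 0 < x l) -> c * \prod_(l <- ls) x l ^+ V l <=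
     mper (nseq (\sum_(l <- ls) V l) [ffun e => \sum_(l <- ls) x l * a l e] ++ pre) K) ->
  c * \prod_(l <- ls) (V l)%:R ^+ V l <=
    mper (rep_cols ls ++ pre) K * (\sum_(l <- ls) V l)%:R ^+ (\sum_(l <- ls) V l)%N.
Proof.
elim: ls pre c => [|l ls IH] pre c /=.
  move=> _ _ _ /(_ (fun=> 1) (fun=> ltr01)).
  by rewrite !big_nil /= expr0 !mulr1.
move=> /andP[lls uls] pre0; rewrite !big_cons; set d := (\sum_(j <- ls) V j)%N => Ksum H.
(* For the last variable the column [b] used below would be an empty sum, hence not positive;
   setting the variable to [1] is enough. *)
have [ls0|ls0] := eqVneq ls [::].
  have := H (fun=> 1) (fun=> ltr01).
  rewrite /d /rep_cols ls0 !big_nil /= !big_cons !big_nil expr1n !mulr1 addn0 cats0 => cP.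
  rewrite ler_wpM2r ?(ltW (natX_gt0 _)) // (le_trans cP) //.
  by apply: eq_leW; congr (mper (nseq _ _ ++ _) _); apply/ffunP => e;
    rewrite ffunE big_cons big_nil mul1r addr0.
pose c' := c * ((V l)%:R ^+ V l * d%:R ^+ d) / (V l + d)%:R ^+ (V l + d).
have dX0 := natX_gt0 d.
have catE Q : mper (nseq d Q ++ nseq (V l) (a l) ++ pre) K =
    mper (nseq (V l) (a l) ++ nseq d Q ++ pre) K.
  by apply: mper_perm; rewrite perm_catCA perm_refl.
have := IH (nseq (V l) (a l) ++ pre) c' uls.
rewrite all_cat pos_nseq // pre0 size_cat size_nseq -/d => /(_ isT) {}IH.
have : c' * \prod_(l <- ls) (V l)%:R ^+ V l <=
    mper (rep_cols ls ++ nseq (V l) (a l) ++ pre) K * d%:R ^+ d.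
  apply: IH => [|x x0]; first by rewrite Ksum addnA (addnC (V l)).
  pose b : {ffun T -> F} := [ffun e => \sum_(j <- ls) x j * a j e].
  have b0 : pos_col b.
    apply/forallP => e; rewrite ffunE; case: (ls) ls0 => // j js _.
    rewrite big_cons ltr_pwDl ?mulr_gt0 ?(forallP (a_gt0 _)) //.
    by apply: sumr_ge0 => k _; rewrite mulr_ge0 // ltW // (forallP (a_gt0 _)).
  have := @gurvits_step pre (a l) b (V l + d) (V l) (c * \prod_(j <- ls) x j ^+ V j) K
    pre0 (a_gt0 l) b0 (leq_addr _ _) Ksum.
  rewrite addKn => step.
  rewrite /c' catE mulrAC ler_pdivrMr ?natX_gt0 // mulrAC.
  apply: step => t t0.
  have := H (fun j => if j == l then t else x j); rewrite !big_cons eqxx -/d.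
  have x'0 j : 0 < (if j == l then t else x j) by case: eqP.
  move/(_ x'0).
  have tailE (R : Type) (idx : R) (op : R -> R -> R) (f : L -> F -> R) :
    \big[op/idx]_(j <- ls) f j (if j == l then t else x j) =
    \big[op/idx]_(j <- ls) f j (x j).
    rewrite [LHS]big_seq [RHS]big_seq; apply: eq_bigr => j jls.
    by case: eqP => // jl; rewrite -jl jls in lls.
  rewrite (tailE _ _ _ (fun j y => y ^+ V j)) => cP.
  rewrite -mulrA [_ * t ^+ _]mulrC; apply: le_trans cP _.
  apply: eq_leW.
  congr (mper (nseq _ _ ++ _) _); apply/ffunP => e.
  by rewrite !ffunE big_cons eqxx (tailE _ _ _ (fun j y => y * a j e)).
have -> : mper (rep_cols ls ++ nseq (V l) (a l) ++ pre) K = mper (rep_cols (l :: ls) ++ pre) K.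
  by apply: mper_perm; rewrite /rep_cols /= -catA perm_catCA perm_refl.
rewrite /c' mulrAC ler_pdivrMr ?natX_gt0 // => le1.
rewrite -(ler_pM2r dX0) (le_trans _ (le_trans le1 _)) //;
  by apply: eq_leW; ring.
Qed.

End Gurvits.

Section DividedPower.
Variable F : realFieldType.
Implicit Types x : F.

Definition dpow x (k : nat) : F := x ^+ k / k`!%:R.

Lemma fact_neq0 n : n`!%:R != 0 :> F.
Proof. by rewrite pnatr_eq0 -lt0n fact_gt0. Qed.

Lemma factr_gt0 n : 0 < n`!%:R :> F.
Proof. by rewrite ltr0n fact_gt0. Qed.

Lemma dpow0 x : dpow x 0 = 1.
Proof. by rewrite /dpow expr0 fact0 divr1. Qed.

Lemma dpowS x k : k.+1%:R * dpow x k.+1 = x * dpow x k.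
Proof.
rewrite /dpow factS natrM exprS; field.
by rewrite fact_neq0 lt0r_neq0 // ltr_wpDr ?ler0n.
Qed.

Lemma dpow_ge0 x k : 0 <= x -> 0 <= dpow x k.
Proof. by move=> x0; rewrite divr_ge0 ?exprn_ge0 // ler0n. Qed.

End DividedPower.

Section Limit.
Variables (F : realFieldType) (T : finType).
Implicit Types (K : {ffun T -> nat}).

(** Removing one unit of row [e] multiplies the product by [K e / b e], and the [K e] sum to [n].
    This translates mixed permanents with equal columns into products of powers of linear forms. *)
Lemma mper_nseq n (b : {ffun T -> F}) K : (\sum_e K e = n)%N ->
  mper (nseq n b) K = n`!%:R * \prod_e dpow (b e) (K e).
Proof.
elim: n K => [|n IH] K Kn.
  move/eqP: (Kn); rewrite sum_nat_eq0 => /forallP K0.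
  have {}K0 e : K e = 0%N by apply/eqP; exact: K0.
  rewrite /= (_ : K == _) ?mul1r; last by apply/eqP/ffunP => e; rewrite K0 ffunE.
  by rewrite big1 // => e _; rewrite K0 dpow0.
rewrite /=; transitivity
    (\sum_(e | (0 < K e)%N) n`!%:R * ((K e)%:R * \prod_f dpow (b f) (K f))).
  apply: eq_bigr => e Ke; rewrite IH; last by move: Kn; rewrite (sum_decr Ke) => -[].
  rewrite mulrCA; congr (_ * _).
  rewrite (bigD1 e) //= [in RHS](bigD1 e) //= [LHS]mulrA [RHS]mulrA; congr (_ * _).
    by rewrite ffunE eqxx subn1; case: (K e) Ke => // k _; rewrite dpowS.
  by apply: eq_bigr => f /negPf fe; rewrite ffunE fe subn0.
rewrite -mulr_sumr -mulr_suml factS natrM -mulrA mulrCA; congr (_ * (_ * _)).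
rewrite -Kn natr_sum [RHS](bigID (fun e => (0 < K e)%N)) /= [X in _ + X]big1 ?addr0 // => e.
by rewrite -eqn0Ngt => /eqP->.
Qed.

Definition shift_col (u : F) (c : {ffun T -> F}) : {ffun T -> F} := [ffun e => c e + u].

Lemma mper_poly (s : seq {ffun T -> F}) K :
  exists p : {poly F}, forall u, mper (map (shift_col u) s) K = p.[u].
Proof.
elim: s K => [|c s IH] K; first by exists (K == [ffun=> 0%N])%:R%:P => u; rewrite hornerC.
have /fin_all_exists [p pE] := fun e => IH (decr K e).
exists (\sum_(e | (0 < K e)%N) ((c e)%:P + 'X) * p e) => u.
by rewrite /= horner_sum; apply: eq_bigr => e _; rewrite ffunE pE !hornerE.
Qed.

Variables (L : finType) (a : L -> {ffun T -> F}) (V : L -> nat).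

(** Shifting all columns by [u > 0] makes them positive and only enlarges the right-hand side of the
    hypothesis; the conclusion is polynomial in [u], so [poly_ge0_right] lets [u] tend to zero. *)
Lemma gurvits_ge0 (c : F) K (n := (\sum_l V l)%N) :
  (forall l e, 0 <= a l e) -> (\sum_e K e = n)%N ->
  (forall x : L -> F, (forall l, 0 < x l) ->
     c * \prod_l x l ^+ V l <= n`!%:R * \prod_e dpow (\sum_l x l * a l e) (K e)) ->
  c * \prod_l (V l)%:R ^+ V l <= mper (rep_cols a V (index_enum L)) K * n%:R ^+ n.
Proof.
move=> a0 Ksum H.
have [p pE] := mper_poly (rep_cols a V (index_enum L)) K.
have := @poly_ge0_right _ (p * (n%:R ^+ n)%:P - (c * \prod_l (V l)%:R ^+ V l)%:P).
rewrite !hornerE subr_ge0 -pE (_ : map _ _ = rep_cols a V (index_enum L)); last first.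
  by rewrite -[RHS]map_id; apply: eq_map => b; apply/ffunP => e; rewrite ffunE addr0.
apply=> u u0; rewrite !hornerE subr_ge0 -pE.
have -> : map (shift_col u) (rep_cols a V (index_enum L)) =
    rep_cols (fun l => shift_col u (a l)) V (index_enum L).
  rewrite /rep_cols map_flatten -map_comp; congr flatten; apply: eq_map => l /=.
  by rewrite map_nseq.
have au0 l : pos_col (shift_col u (a l)).
  by apply/forallP => e; rewrite ffunE ltr_wpDl.
have := gurvits au0 (pre := [::]) (c := c) (K := K) (V := V) (index_enum_uniq L) isT Ksum.
rewrite cats0; apply=> x x0; rewrite cats0 mper_nseq //.
apply: le_trans (H x x0) _; rewrite ler_wpM2l ?ler0n //.
apply: ler_prod => e _.
have s0 : 0 <= \sum_l x l * a l e by apply: sumr_ge0 => l _; rewrite mulr_ge0 // ltW.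
rewrite dpow_ge0 //= /dpow ler_pM2r ?invr_gt0 ?factr_gt0 // lerXn2r ?nnegrE //.
  by rewrite ffunE; apply: sumr_ge0 => l _; rewrite ffunE mulr_ge0 ?(ltW (x0 l)) // addr_ge0 // ltW.
rewrite ffunE; apply: ler_sum => l _; rewrite ffunE ler_wpM2l ?(ltW (x0 l)) //.
by rewrite lerDl ltW.
Qed.

End Limit.

(** * Counting tables with weights *)

Section TableSum.
Variables (F : realFieldType) (I J : finType) (M : nat).
Local Notation T := (I * J)%type.
Local Notation L := (I + J)%type.
Implicit Types (K : {ffun T -> nat}) (V : L -> nat) (A : {ffun T -> 'I_M.+1}).
Variables (s t : T -> F).

(** The column conditions bear on [K - A], so that [A] and [K - A] are the exponents of the row and
    of the column variables. Entries are in ['I_M.+1] to have finitely many arrays; the main lemmas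
    assume that [M] bounds [K]. *)
Definition istable K V A := [&& [forall e, (A e <= K e)%N],
  [forall i, \sum_j A (i, j) == V (inl i)]%N &
  [forall j, \sum_i (K (i, j) - A (i, j)) == V (inr j)]%N].

(** The coefficient of [x^V] in the product over the cells [e = (i,j)] of the divided powers
    [dpow (s e * x_i + t e * y_j) (K e)]. *)
Definition tabsum K V : F := \sum_(A | istable K V A)
  \prod_e (dpow (s e) (A e) * dpow (t e) (K e - A e)).

(** The coefficients of the variable [l] in the linear forms of all cells. *)
Definition bicol (l : L) : {ffun T -> F} := [ffun e =>
  match l with
  | inl i => if e.1 == i then s e else 0
  | inr j => if e.2 == j then t e else 0
  end].

Let bump V l := fun l' => ((l == l') + V l')%N.

Lemma istableP K V A : reflect
  [/\ forall e, (A e <= K e)%N,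
      forall i, (\sum_j A (i, j) = V (inl i))%N &
      forall j, (\sum_i (K (i, j) - A (i, j)) = V (inr j))%N]
  (istable K V A).
Proof.
apply: (iffP and3P) => -[h1 h2 h3]; split.
- by move=> e; exact: (forallP h1).
- by move=> i; apply/eqP; exact: (forallP h2).
- by move=> j; apply/eqP; exact: (forallP h3).
- exact/forallP.
- by apply/forallP => i; exact/eqP.
- by apply/forallP => j; exact/eqP.
Qed.

Lemma sum_fst_if (f : T -> nat) i :
  (\sum_e (if e.1 == i then f e else 0) = \sum_j f (i, j))%N.
Proof.
transitivity (\sum_k \sum_j (if k == i then f (k, j) else 0))%N.
  by rewrite pair_bigA; apply: eq_bigr => -[].
rewrite (bigD1 i) //= [X in (_ + X)%N]big1 ?addn0 => [|k /negPf ki]; last first.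
  by rewrite big1 // => j _; rewrite ki.
by apply: eq_bigr => j _; rewrite eqxx.
Qed.

Lemma sum_snd_if (f : T -> nat) j :
  (\sum_e (if e.2 == j then f e else 0) = \sum_i f (i, j))%N.
Proof.
transitivity (\sum_i \sum_k (if k == j then f (i, k) else 0))%N.
  by rewrite pair_bigA; apply: eq_bigr => -[].
apply: eq_bigr => i _; rewrite (bigD1 j) //= eqxx big1 ?addn0 // => k /negPf ->.
by [].
Qed.

Lemma sum_dec_at (n : nat) (B : finType) (f g : B -> nat) b :
  (forall c, c != b -> f c = g c) -> (f b = (g b).+1)%N ->
  (\sum_c f c = n.+1)%N -> (\sum_c g c = n)%N.
Proof.
move=> fg fb; rewrite (bigD1 b) //= fb (eq_bigr g) // addSn => -[<-].
by rewrite [LHS](bigD1 b).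
Qed.

Lemma sum_inc_at (n : nat) (B : finType) (f g : B -> nat) b :
  (forall c, c != b -> f c = g c) -> (f b = (g b).+1)%N ->
  (\sum_c g c = n)%N -> (\sum_c f c = n.+1)%N.
Proof.
move=> fg fb <-; rewrite (bigD1 b) //= fb (eq_bigr g) // addSn.
by rewrite [in RHS](bigD1 b).
Qed.

Let incr e A : {ffun T -> 'I_M.+1} := [ffun f => inord (A f + (f == e))].
Let dec e A : {ffun T -> 'I_M.+1} := [ffun f => inord (A f - (f == e))].

Let decE e A f : dec e A f = (A f - (f == e))%N :> nat.
Proof. by rewrite ffunE inordK // (leq_ltn_trans (leq_subr _ _)). Qed.

Let incrE e A f : (A e < M)%N -> incr e A f = (A f + (f == e))%N :> nat.
Proof.
move=> AM; rewrite ffunE inordK //; have [->|_] := eqVneq f e.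
  by rewrite addn1 ltnS.
by rewrite addn0.
Qed.

(** On overflow [inord] returns [0], so a positive value certifies that the increment was
    genuine. *)
Let incr_lt e A : (0 < incr e A e)%N -> (A e < M)%N.
Proof.
by rewrite ffunE eqxx addn1 /inord val_insubd ltnS; case: ifP.
Qed.

Lemma istable_incr K V A e : (0 < K e)%N -> (A e < M)%N ->
  istable K (bump V (inl e.1)) (incr e A) = istable (decr K e) V A.
Proof.
case: e => i j Ke AM; have iE := fun f => incrE f AM.
have subE f : (K f - incr (i, j) A f = decr K (i, j) f - A f)%N.
  by rewrite iE ffunE subnDA subnAC.
apply/istableP/istableP => -[h1 h2 h3]; split.
- move=> f; have := h1 f; rewrite iE ffunE; case: eqP => //= _; lia.
- move=> k; have := h2 k; rewrite /bump; have [ki|ki] := eqVneq k i.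
    rewrite ki eqxx add1n; apply: (sum_dec_at (b := j)) => [l lj|].
      by rewrite iE xpair_eqE (negPf lj) andbF addn0.
    by rewrite iE eqxx addn1.
  rewrite (_ : _ == _ = false) ?add0n => [<-|]; last first.
    by apply/eqP => -[ik]; rewrite ik eqxx in ki.
  by apply: eq_bigr => l _; rewrite iE xpair_eqE (negPf ki) addn0.
- by move=> k; have := h3 k; rewrite /bump add0n => <-; apply: eq_bigr => l _; rewrite subE.
- move=> f; have := h1 f; rewrite iE ffunE; move: Ke.
  by have [->|_] := eqVneq f (i, j); rewrite /= ?subn1 ?addn1 ?subn0 ?addn0 => *; lia.
- move=> k; have := h2 k; rewrite /bump; have [ki|ki] := eqVneq k i.
    rewrite ki eqxx add1n; apply: (sum_inc_at (b := j)) => [l lj|].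
      by rewrite iE xpair_eqE (negPf lj) andbF addn0.
    by rewrite iE eqxx addn1.
  rewrite (_ : _ == _ = false) ?add0n => [<-|]; last first.
    by apply/eqP => -[ik]; rewrite ik eqxx in ki.
  by apply: eq_bigr => l _; rewrite iE xpair_eqE (negPf ki) addn0.
- by move=> k; have := h3 k; rewrite /bump add0n => <-; apply: eq_bigr => l _; rewrite subE.
Qed.

Lemma istable_decr K V A e : (0 < K e)%N ->
  istable K (bump V (inr e.2)) A && (A e < K e)%N = istable (decr K e) V A.
Proof.
case: e => i j Ke.
have sub_ij : (A (i, j) < K (i, j))%N ->
    (K (i, j) - A (i, j) = (decr K (i, j) (i, j) - A (i, j)).+1)%N.
  rewrite ffunE eqxx subn1; move: (K (i, j)) (nat_of_ord (A (i, j))) => k a; lia.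
have sub_ne l k : (l, k) != (i, j) -> (K (l, k) - A (l, k) = decr K (i, j) (l, k) - A (l, k))%N.
  by move=> /negPf ne; rewrite ffunE ne subn0.
apply/andP/istableP => [[/istableP[h1 h2 h3] Aij]|[h1 h2 h3]].
  split=> [f|k|k]; [|exact: h2|].
    have := h1 f; rewrite ffunE; move: Aij.
    by have [->|_] := eqVneq f (i, j); rewrite /= ?subn1 ?subn0; lia.
  have := h3 k; rewrite /bump; have [kj|kj] := eqVneq k j.
    rewrite kj eqxx add1n; apply: (sum_dec_at (b := i)) => [l li|]; last exact: sub_ij.
    by apply: sub_ne; rewrite xpair_eqE (negPf li).
  rewrite (_ : _ == _ = false) ?add0n => [<-|]; last first.
    by apply/eqP => -[jk]; rewrite jk eqxx in kj.
  by apply: eq_bigr => l _; rewrite sub_ne // xpair_eqE (negPf kj) andbF.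
have Aij : (A (i, j) < K (i, j))%N.
  have := h1 (i, j); rewrite ffunE eqxx subn1; move: Ke.
  by move: (K (i, j)) (nat_of_ord (A (i, j))) => k a; lia.
split=> //; apply/istableP; split=> [f|k|k]; [|exact: h2|].
  by apply: leq_trans (h1 f) _; rewrite ffunE leq_subr.
have := h3 k; rewrite /bump; have [kj|kj] := eqVneq k j.
  rewrite kj eqxx add1n; apply: (sum_inc_at (b := i)) => [l li|]; last exact: sub_ij.
  by apply: sub_ne; rewrite xpair_eqE (negPf li).
rewrite (_ : _ == _ = false) ?add0n => [<-|]; last first.
  by apply/eqP => -[jk]; rewrite jk eqxx in kj.
by apply: eq_bigr => l _; rewrite sub_ne // xpair_eqE (negPf kj) andbF.
Qed.

(** Taking a unit from [A e] and from [K e] keeps [K - A] and maps the tables with [A e > 0]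
    bijectively to those of [decr K e]; [dpowS] absorbs the factor [A e]. *)
Lemma tabsum_left K V e : (0 < K e <= M)%N ->
  \sum_(A | istable K (bump V (inl e.1)) A)
    (A e)%:R * \prod_f (dpow (s f) (A f) * dpow (t f) (K f - A f)) =
  s e * tabsum (decr K e) V.
Proof.
move=> /andP[Ke KM]; rewrite (bigID (fun A => (0 < A e)%N)) /=.
rewrite [X in _ + X]big1 ?addr0; last by move=> A /andP[_]; rewrite lt0n negbK => /eqP->; rewrite mul0r.
rewrite (reindex_onto (incr e) (dec e)) /= => [|A /andP[_ A0]]; last first.
  apply/ffunP => f; apply/val_inj; rewrite /= incrE; last first.
    by rewrite decE eqxx; have := ltn_ord (A e); lia.
  by rewrite decE; case: eqVneq => [->|]; lia.
rewrite /tabsum mulr_sumr; apply: eq_big => [A|A /andP[/andP[_ A0] /eqP AE]].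
  apply/andP/idP => [[/andP[]]|tA].
    by move=> + A0 /eqP AE; rewrite istable_incr // incr_lt.
  have AM : (A e < M)%N.
    case/istableP: tA => /(_ e); rewrite ffunE eqxx subn1 => AK _ _.
    by move: (K e) Ke KM AK => k; move: (nat_of_ord (A e)) => a *; lia.
  rewrite istable_incr // tA incrE // eqxx addn1; split=> //.
  apply/eqP/ffunP => f; apply/val_inj; rewrite /= decE incrE //; lia.
have AM := incr_lt A0.
rewrite (bigD1 e) //= [in RHS](bigD1 e) //= [LHS]mulrA [RHS]mulrA; congr (_ * _).
  rewrite incrE // eqxx addn1 [LHS]mulrA dpowS ffunE eqxx.
  rewrite [RHS]mulrA; congr (_ * dpow _ _).
  by move: (K e) (nat_of_ord (A e)) => k a; rewrite subn1; lia.
apply: eq_bigr => f /negPf fe; rewrite incrE // fe addn0 ffunE fe subn0 //.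
Qed.

Lemma tabsum_right K V e : (0 < K e)%N ->
  \sum_(A | istable K (bump V (inr e.2)) A)
    (K e - A e)%:R * \prod_f (dpow (s f) (A f) * dpow (t f) (K f - A f)) =
  t e * tabsum (decr K e) V.
Proof.
move=> Ke; rewrite (bigID (fun A => (A e < K e)%N)) /=.
rewrite [X in _ + X]big1 ?addr0; last first.
  by move=> A /andP[_]; rewrite -leqNgt -subn_eq0 => /eqP->; rewrite mul0r.
rewrite /tabsum mulr_sumr; apply: eq_big => [A|A /andP[_ AK]].
  exact: istable_decr.
rewrite (bigD1 e) //= [in RHS](bigD1 e) //= [LHS]mulrA [RHS]mulrA; congr (_ * _).
  rewrite ffunE eqxx (_ : (K e - A e = (K e - 1 - A e).+1)%N); last by lia.
  by rewrite mulrCA dpowS; ring.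
by apply: eq_bigr => f /negPf fe; rewrite ffunE fe subn0.
Qed.

(** Differentiation of the generating product in the variable [l]: the margin [V l + 1] is spread
    over the cells that make it up. This is the expansion of [mper] along the column [bicol l], up
    to the factor [V l + 1], which builds the factorials of [mper_bicol]. *)
Lemma tabsum_rec K V l : (forall e, (K e <= M)%N) ->
  (V l).+1%:R * tabsum K (bump V l) =
  \sum_(e | (0 < K e)%N) bicol l e * tabsum (decr K e) V.
Proof.
move=> KM; rewrite /tabsum mulr_sumr; case: l => [i|j].
  transitivity (\sum_(A | istable K (bump V (inl i)) A) \sum_e
    (if e.1 == i then A e : nat else 0)%:R * \prod_f (dpow (s f) (A f) * dpow (t f) (K f - A f))).
    apply: eq_bigr => A /istableP[_ h _]; rewrite -mulr_suml -natr_sum sum_fst_if h.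
    by rewrite /bump eqxx.
  rewrite exchange_big [LHS](bigID (fun e => (0 < K e)%N)) /= [X in _ + X]big1 ?addr0; last first.
    move=> e; rewrite -leqNgt leqn0 => /eqP Ke; rewrite big1 // => A /istableP[/(_ e)].
    by rewrite Ke leqn0 => /eqP-> _ _; case: ifP; rewrite mul0r.
  apply: eq_bigr => e Ke; rewrite ffunE; case: eqP => [<-|_].
    by rewrite tabsum_left // Ke KM.
  by rewrite mul0r big1 // => A _; rewrite mul0r.
transitivity (\sum_(A | istable K (bump V (inr j)) A) \sum_e
  (if e.2 == j then K e - A e else 0)%N%:R * \prod_f (dpow (s f) (A f) * dpow (t f) (K f - A f))).
  apply: eq_bigr => A /istableP[_ _ h].
  by rewrite -mulr_suml -natr_sum (sum_snd_if (fun e => K e - A e)%N) h /bump eqxx.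
rewrite exchange_big [LHS](bigID (fun e => (0 < K e)%N)) /= [X in _ + X]big1 ?addr0; last first.
  move=> e; rewrite -leqNgt leqn0 => /eqP Ke; rewrite big1 // => A _.
  by rewrite Ke sub0n; case: ifP; rewrite mul0r.
apply: eq_bigr => e Ke; rewrite ffunE; case: eqP => [<-|_]; first by rewrite tabsum_right.
by rewrite mul0r big1 // => A _; rewrite mul0r.
Qed.

Lemma tabsum0 K : tabsum K (fun=> 0%N) = (K == [ffun=> 0%N])%:R.
Proof.
have z0 K' A : istable K' (fun=> 0%N) A -> forall e, (A e = 0 :> nat) /\ (K' e = 0)%N.
  move=> /istableP[h1 h2 h3] [i j].
  have A0 : A (i, j) = 0%N :> nat.
    by apply/eqP; have := h2 i => /eqP; rewrite sum_nat_eq0 => /forallP/(_ j).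
  split=> //; have := h3 j => /eqP; rewrite sum_nat_eq0 => /forallP/(_ i).
  by rewrite /= A0 subn0 => /eqP.
have [->|K0] := eqVneq K [ffun=> 0%N]; last first.
  rewrite /tabsum big1 // => A tA; have h := z0 _ A tA; case/eqP: K0; apply/ffunP => e; rewrite ffunE.
  by have [] := h e.
rewrite /tabsum (big_pred1 [ffun=> ord0]) => [|A] /=.
  by rewrite big1 // => e _; rewrite !ffunE !dpow0 mulr1.
apply/idP/eqP => [tA|->].
  by apply/ffunP => e; apply/val_inj; rewrite ffunE; have [] := z0 _ A tA e.
apply/istableP; split=> [e|i|j]; rewrite ?ffunE //.
  by rewrite big1 // => j _; rewrite ffunE.
by rewrite big1 // => i _; rewrite !ffunE.
Qed.

Lemma mper_bicol (ls : seq L) K : (forall e, (K e <= M)%N) ->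
  mper (map bicol ls) K =
  (\prod_l (count_mem l ls)`!)%:R * tabsum K (fun l => count_mem l ls).
Proof.
elim: ls K => [|l ls IH] K KM; first by rewrite tabsum0 big1 ?mul1r.
rewrite [LHS]/=; under eq_bigr => e _.
  rewrite IH; last by move=> f; rewrite ffunE (leq_trans (leq_subr _ _)).
  rewrite mulrCA; over.
rewrite -mulr_sumr -tabsum_rec // mulrA; congr (_ * _).
rewrite -natrM; congr (_%:R); rewrite (bigD1 l) //= [RHS](bigD1 l) //= eqxx add1n factS.
rewrite mulnAC [(_`! * _)%N in LHS]mulnC; congr (_ * _)%N; apply: eq_bigr => k /negPf kl.
by rewrite eq_sym kl.
Qed.

End TableSum.

(** * Comparison of a coefficient with the values of its polynomial *)

Section Bounds.
Variables (F : realType).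

Lemma prod_natX_gt0 (L : finType) (V : L -> nat) : 0 < \prod_l (V l)%:R ^+ V l :> F.
Proof. by apply: prodr_gt0 => l _; exact: natX_gt0. Qed.

Lemma prodr_fact_gt0 (L : finType) (V : L -> nat) : 0 < \prod_l (V l)`!%:R :> F.
Proof. by apply: prodr_gt0 => l _; exact: factr_gt0. Qed.

(** Termwise [q^V <= V^V * exp (q - V)], from [1 + x <= exp x]; the exponentials multiply to at most
    [1]. This form needs no logarithm of a vanishing [q l]. *)
Lemma gibbs (L : finType) (V : L -> nat) (q : L -> F) :
  (forall l, 0 <= q l) -> \sum_l q l <= (\sum_l V l)%:R ->
  \prod_l q l ^+ V l <= \prod_l (V l)%:R ^+ V l.
Proof.
move=> q0 qV.
have term l : q l ^+ V l <= (V l)%:R ^+ V l * expR (q l - (V l)%:R).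
  have [->|V0] := posnP (V l); first by rewrite !expr0 mul1r subr0 (le_trans _ (expR_ge1Dx _)) // lerDl.
  have -> : q l - (V l)%:R = (q l / (V l)%:R - 1) * (V l)%:R.
    by rewrite mulrBl mul1r divfK // pnatr_eq0 -lt0n.
  rewrite expRM_natr -exprMn lerXn2r ?nnegrE ?mulr_ge0 ?expR_ge0 //.
  rewrite -ler_pdivrMl ?ltr0n // mulrC.
  by apply: le_trans (expR_ge1Dx _); rewrite addrC subrK.
apply: (@le_trans _ _ (\prod_l ((V l)%:R ^+ V l * expR (q l - (V l)%:R)))).
  by apply: ler_prod => l _; rewrite exprn_ge0 //= term.
rewrite big_split /= -expR_sum sumrB -natr_sum ler_piMr ?(ltW (prod_natX_gt0 _)) //.
by rewrite expR_le1 subr_le0.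
Qed.

Variable T : finType.
Implicit Types (K : {ffun T -> nat}).

(* This evaluates the polynomial of the transposed matrix: [mper cs K] is the
  coefficient of [z^K] in the right-hand side. *)
Lemma mper_le_prod (cs : seq {ffun T -> F}) K (z : T -> F) :
  (forall c, c \in cs -> forall e, 0 <= c e) -> (forall e, 0 <= z e) ->
  mper cs K * \prod_e z e ^+ K e <= \prod_(c <- cs) \sum_e c e * z e.
Proof.
move=> + z0; elim: cs K => [|c cs IH] K cs0.
  rewrite big_nil /=; case: eqP => [->|_]; last by rewrite mul0r ler01.
  by rewrite mul1r big1 // => e _; rewrite ffunE expr0.
have c0 := cs0 c (mem_head _ _).
have {}cs0 d : d \in cs -> forall e, 0 <= d e by move=> dcs; apply: cs0; rewrite inE dcs orbT.
rewrite big_cons /= !mulr_suml big_mkcond /=; apply: ler_sum => e _.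
have P0 : 0 <= \prod_(c <- cs) \sum_e c e * z e.
  rewrite big_seq; apply: prodr_ge0 => d dcs; apply: sumr_ge0 => f _.
  by rewrite mulr_ge0 // cs0.
case: ifP => Ke; last by rewrite !mulr_ge0.
have -> : \prod_f z f ^+ K f = z e * \prod_f z f ^+ decr K e f.
  rewrite (bigD1 e) //= [in RHS](bigD1 e) //= [RHS]mulrA ffunE eqxx; congr (_ * _).
    by rewrite subn1 -exprS prednK.
  by apply: eq_bigr => f /negPf fe; rewrite ffunE fe subn0.
rewrite -mulrA [_ * (z e * _)]mulrCA [leLHS]mulrA ler_wpM2l ?mulr_ge0 //.
exact: IH.
Qed.

End Bounds.

Section TabsumBounds.
Variables (F : realType) (I J : finType) (M : nat).
Local Notation T := (I * J)%type.
Local Notation L := (I + J)%type.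
Variables (K : {ffun T -> nat}) (V : L -> nat) (s t : T -> F).
Hypotheses (KM : forall e, (K e <= M)%N) (Vsum : (\sum_l V l = \sum_e K e)%N).
Hypotheses (s0 : forall e, 0 <= s e) (t0 : forall e, 0 <= t e).

Definition biform (x : L -> F) (e : T) := s e * x (inl e.1) + t e * x (inr e.2).

Lemma biformE x e : \sum_l x l * bicol s t l e = biform x e.
Proof.
rewrite big_sumType /=; congr (_ + _).
  rewrite (bigD1 e.1) //= ffunE eqxx mulrC big1 ?addr0 // => i /negPf ie.
  by rewrite ffunE eq_sym ie mulr0.
rewrite (bigD1 e.2) //= ffunE eqxx mulrC big1 ?addr0 // => i /negPf ie.
by rewrite ffunE eq_sym ie mulr0.
Qed.

Lemma eq_tabsum V1 V2 : V1 =1 V2 -> tabsum M s t K V1 = tabsum M s t K V2.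
Proof.
move=> V12; apply: eq_bigl => A.
by apply/istableP/istableP => -[h1 h2 h3]; split=> // i; rewrite ?h2 ?h3 ?V12.
Qed.

Lemma mper_rep_bicol : mper (rep_cols (bicol s t) V (index_enum L)) K =
  \prod_l (V l)`!%:R * tabsum M s t K V.
Proof.
pose ls := flatten [seq nseq (V l) l | l <- index_enum L].
have cntE l : count_mem l ls = V l.
  rewrite count_flatten -map_comp sumnE big_map (bigD1 l) //= count_nseq /= eqxx mul1n.
  by rewrite big1 ?addn0 // => k /negPf kl; rewrite count_nseq /= kl.
have -> : rep_cols (bicol s t) V (index_enum L) = map (bicol s t) ls.
  rewrite /rep_cols map_flatten -map_comp; congr flatten; apply: eq_map => l /=.
  by rewrite map_nseq.
rewrite (mper_bicol _ _ _ KM) (eq_tabsum cntE) natr_prod; congr (_ * _).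
by apply: eq_bigr => l _; rewrite cntE.
Qed.

Lemma bicol_ge0 l e : 0 <= bicol s t l e.
Proof. by rewrite ffunE; case: l => i; case: ifP. Qed.

Lemma prod_fst (x : L -> F) (A : T -> nat) :
  \prod_e x (inl e.1) ^+ A e = \prod_i x (inl i) ^+ (\sum_j A (i, j))%N.
Proof.
transitivity (\prod_i \prod_j x (inl i) ^+ A (i, j)).
  by rewrite pair_bigA; apply: eq_bigr => -[].
by apply: eq_bigr => i _; rewrite prodrXr.
Qed.

Lemma prod_snd (x : L -> F) (A : T -> nat) :
  \prod_e x (inr e.2) ^+ A e = \prod_j x (inr j) ^+ (\sum_i A (i, j))%N.
Proof.
transitivity (\prod_i \prod_j x (inr j) ^+ A (i, j)).
  by rewrite pair_bigA; apply: eq_bigr => -[].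
by rewrite exchange_big; apply: eq_bigr => i _; rewrite prodrXr.
Qed.

(** An instance of [gurvits_ge0] for the columns [bicol]. The constant is rescaled by [n! / prod K!]
    because the hypothesis is about powers and [gurvits_ge0] about divided powers. *)
Lemma tabsum_lower (c : F) (n := (\sum_e K e)%N) :
  (forall x, (forall l, 0 < x l) -> c * \prod_l x l ^+ V l <= \prod_e biform x e ^+ K e) ->
  c * (n`!%:R * \prod_l (V l)%:R ^+ V l) <=
    \prod_l (V l)`!%:R * (\prod_e (K e)`!%:R * tabsum M s t K V) * n%:R ^+ n.
Proof.
move=> H; have Kf0 := @prodr_fact_gt0 F T K.
have := @gurvits_ge0 F T L (bicol s t) V (c * n`!%:R / \prod_e (K e)`!%:R) K bicol_ge0 (esym Vsum).
rewrite mper_rep_bicol Vsum -/n => le1.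
have {}le1 := le1 _; rewrite -(ler_pM2r Kf0) in le1.
have KfN0 := gt_eqF Kf0; apply: le_trans (le_trans (le1 _) _).
- by apply: eq_leW; field; rewrite KfN0.
- move=> x x0; have -> : \prod_e dpow (\sum_l x l * bicol s t l e) (K e) =
      \prod_e (biform x e ^+ K e / (K e)`!%:R).
    by apply: eq_bigr => e _; rewrite biformE.
  rewrite prodf_div -(ler_pM2r Kf0) -[leRHS]mulrA divfK ?KfN0 //.
  apply: (@le_trans _ _ (n`!%:R * (c * \prod_l x l ^+ V l))).
    by apply: eq_leW; field; rewrite KfN0.
  by rewrite ler_wpM2l ?ler0n //; exact: H.
- by apply: eq_leW; ring.
Qed.

(** The expanded product has nonnegative terms, and the arrays with other margins are dropped. *)
Lemma tabsum_upper (x : L -> F) : (forall l, 0 <= x l) ->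
  \prod_e (K e)`!%:R * tabsum M s t K V * \prod_l x l ^+ V l <= \prod_e biform x e ^+ K e.
Proof.
move=> x0; have Kf0 := @prodr_fact_gt0 F T K.
pose g e (k : 'I_M.+1) := if (k <= K e)%N then
  dpow (s e * x (inl e.1)) k * dpow (t e * x (inr e.2)) (K e - k) else 0.
have g0 e k : 0 <= g e k.
  by rewrite /g; case: ifP => // _; rewrite mulr_ge0 // dpow_ge0 // mulr_ge0.
have gE e : biform x e ^+ K e = (K e)`!%:R * \sum_k g e k.
  rewrite /biform addrC exprDn mulr_sumr.
  rewrite (big_ord_widen M.+1 (fun i => (t e * x (inr e.2)) ^+ (K e - i) *
    (s e * x (inl e.1)) ^+ i *+ 'C(K e, i))) ?ltnS // big_mkcond /=.
  apply: eq_bigr => k _; rewrite ltnS /g; case: ifP => [kK|]; last by rewrite mulr0.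
  rewrite -mulr_natr -(bin_fact kK) !natrM /dpow.
  by field; rewrite !fact_neq0.
rewrite (eq_bigr _ (fun e _ => gE e)) big_split /= bigA_distr_bigA /=.
rewrite -mulrA ler_wpM2l ?(ltW Kf0) // mulr_suml big_mkcond /=.
apply: ler_sum => A _; case: ifP => [/istableP[h1 h2 h3]|_]; last exact: prodr_ge0.
apply: eq_leW.
rewrite big_sumType /=.
under [X in _ * (X * _)]eq_bigr do rewrite -h2.
under [X in _ * (_ * X)]eq_bigr do rewrite -h3.
rewrite -(prod_fst x (fun e => A e)) -(prod_snd x (fun e => K e - A e)%N).
rewrite -!big_split; apply: eq_bigr => e _ /=.
rewrite /g h1 /dpow !exprMn; field; by rewrite !fact_neq0.
Qed.

(* [mper_le_prod] at [z e = K e / biform x e]; then Gibbs' inequality applies. *)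
Lemma tabsum_upper_row (x : L -> F) :
  (forall e, s e + t e = 1) -> (forall l, 0 < x l) ->
  \prod_l (V l)`!%:R * tabsum M s t K V * \prod_e (K e)%:R ^+ K e * \prod_l x l ^+ V l <=
    \prod_l (V l)%:R ^+ V l * \prod_e biform x e ^+ K e.
Proof.
move=> st1 x0; have y0 e : 0 < biform x e.
  rewrite /biform; have := s0 e; rewrite le_eqVlt => /predU1P[se|se]; last first.
    by rewrite ltr_pwDl ?mulr_gt0 // mulr_ge0 // ltW.
  by have := st1 e; rewrite -se mul0r !add0r => ->; rewrite mul1r.
pose z e := (K e)%:R / biform x e.
have z0 e : 0 <= z e by rewrite divr_ge0 ?ler0n // ltW.
have := @mper_le_prod F T (rep_cols (bicol s t) V (index_enum L)) K z.
have cols0 c : c \in rep_cols (bicol s t) V (index_enum L) -> forall e, 0 <= c e.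
  by move=> /flattenP[? /mapP[l _ ->]] /nseqP[-> _] e; exact: bicol_ge0.
move=> /(_ cols0 z0); rewrite mper_rep_bicol /rep_cols big_flatten big_map /=.
under [X in _ <= X -> _]eq_bigr do rewrite big_nseq -Monoid.iteropE /=.
have -> : \prod_e z e ^+ K e = \prod_e (K e)%:R ^+ K e / \prod_e biform x e ^+ K e.
  by rewrite -prodf_div; apply: eq_bigr => e _; rewrite expr_div_n.
have Y0 : 0 < \prod_e biform x e ^+ K e by apply: prodr_gt0 => e _; rewrite exprn_gt0.
have X0 : 0 < \prod_l x l ^+ V l by apply: prodr_gt0 => l _; rewrite exprn_gt0.
rewrite mulrA ler_pdivrMr // => le1.
rewrite -(ler_pM2r X0) in le1; apply: le_trans le1 _.
rewrite mulrAC ler_pM2r // -big_split /=.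
under eq_bigr do rewrite -exprMn.
apply: gibbs => [l|].
  by rewrite mulr_ge0 ?(ltW (x0 l)) // sumr_ge0 // => e _; rewrite mulr_ge0 // bicol_ge0.
have -> : \sum_l (\sum_e bicol s t l e * z e) * x l =
    \sum_l \sum_e bicol s t l e * z e * x l.
  by apply: eq_bigr => l _; rewrite mulr_suml.
rewrite exchange_big /= Vsum natr_sum; apply: ler_sum => e _.
have -> : \sum_l bicol s t l e * z e * x l = z e * biform x e.
  by rewrite -biformE mulr_sumr; apply: eq_bigr => l _; ring.
by rewrite /z divfK // gt_eqF.
Qed.

End TabsumBounds.

Import numFieldNormedType.Exports.
Local Open Scope classical_set_scope.
Local Open Scope ring_scope.

(** * The Prekopa-Leindler inequality, one variable at a time *)

Section UnitInterval.
Variable F : realType.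
Implicit Types (f g h : F -> F) (A B : set F).

Local Notation mu := (@lebesgue_measure F).
Local Notation I01 := (`[0%R, 1%R]%classic : set F).

Definition integral01 f : F := \int[mu]_(x in I01) f x.

(** The bound [1] keeps all integrals finite; it fits because the capacity is at most [1] by
    [capterm0]. *)
Definition admissible f := measurable_fun I01 f /\ forall x, I01 x -> 0 <= f x <= 1.

Lemma I01P x : I01 x <-> 0 <= x <= 1.
Proof. by rewrite /= in_itv. Qed.

Lemma mu_I01 : mu I01 = 1%E.
Proof. by rewrite lebesgue_measure_itv /= lte_fin ltr01 oppr0 adde0. Qed.

Lemma bounded_integrable01 f M : measurable_fun I01 f ->
  (forall x, I01 x -> `|f x| <= M) -> mu.-integrable I01 (EFin \o f).
Proof.
move=> mf fM; apply: measurable_bounded_integrable => //.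
  by rewrite [X in (X < _)%E]mu_I01 ltry.
exists M; split; first exact: num_real.
by move=> y My x Ax; apply: le_trans (fM _ Ax) (ltW My).
Qed.

Lemma admissible_integrable f : admissible f -> mu.-integrable I01 (EFin \o f).
Proof.
move=> [mf f01]; apply: (bounded_integrable01 (M := 1)) => // x /f01 /andP[f0 f1].
by rewrite ger0_norm.
Qed.

Lemma integral01_cst r : integral01 (fun=> r) = r.
Proof. by rewrite /integral01 Rintegral_cst // [X in fine X]mu_I01 mulr1. Qed.

Lemma integrable01D f g : mu.-integrable I01 (EFin \o f) ->
  mu.-integrable I01 (EFin \o g) -> mu.-integrable I01 (EFin \o (fun x => f x + g x)).
Proof.
move=> fi gi; rewrite (_ : _ \o _ = (EFin \o f) \+ (EFin \o g))%E; first exact: integrableD.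
by apply/funext => x; rewrite /= EFinD.
Qed.

Lemma integral01_sum (I : Type) (s : seq I) (G : I -> F -> F) :
  (forall i, mu.-integrable I01 (EFin \o G i)) ->
  mu.-integrable I01 (EFin \o (fun x => \sum_(i <- s) G i x)) /\
  integral01 (fun x => \sum_(i <- s) G i x) = \sum_(i <- s) integral01 (G i).
Proof.
move=> Gi; elim: s => [|i s [IHi IH]].
  have -> : (fun x => \sum_(i <- [::]) G i x) = (fun=> 0).
    by apply/funext => x; rewrite big_nil.
  rewrite integral01_cst big_nil; split=> //.
  by apply: (bounded_integrable01 (M := 0)) => [|x _]; rewrite ?normr0 //; exact: measurable_cst.
have -> : (fun x => \sum_(j <- i :: s) G j x) = (fun x => G i x + \sum_(j <- s) G j x).
  by apply/funext => x; rewrite big_cons.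
split; first exact: integrable01D.
by rewrite big_cons -IH /integral01 RintegralD.
Qed.

Lemma integral01Zl f k : mu.-integrable I01 (EFin \o f) ->
  integral01 (fun x => k * f x) = k * integral01 f.
Proof. by move=> fi; rewrite /integral01 RintegralZl. Qed.

Lemma le_integral01 f g : admissible f -> admissible g ->
  (forall x, I01 x -> f x <= g x) -> integral01 f <= integral01 g.
Proof.
by move=> /admissible_integrable fi /admissible_integrable gi fg; exact: le_Rintegral.
Qed.

Lemma integral01_itv f : admissible f -> 0 <= integral01 f <= 1.
Proof.
move=> fa; have [_ f01] := fa; apply/andP; split.
  by apply: Rintegral_ge0 => x /f01 /andP[].
rewrite -[leRHS](integral01_cst 1); apply: le_integral01 => //.
  by split=> [|x _]; [exact: measurable_cst | rewrite ler01 lexx].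
by move=> x /f01 /andP[].
Qed.

Definition level f t : set F := I01 `&` [set x | t < f x].

Definition quasiconcave f := forall t, is_interval (level f t).

Lemma quasiconcave_measurable f : quasiconcave f -> measurable_fun I01 f.
Proof.
move=> qf mD; apply: (measurability _ (RGenOInfty.measurableE F)) => //.
move=> /= _ [_ [t ->] <-]; apply: is_interval_measurable.
rewrite (_ : _ `&` _ = level f t); first exact: qf.
by congr (_ `&` _); rewrite predeqE => x /=; rewrite in_itv /= andbT.
Qed.

Definition len A : F := fine (mu A).

Lemma sub01_fin A : A `<=` I01 -> measurable A -> mu A \is a fin_num.
Proof.
move=> A01 mA; rewrite ge0_fin_numE ?measure_ge0 //.
have := le_measure mu (mem_set mA) (mem_set (measurable_itv `[0, 1])) A01.
by move=> /le_lt_trans; apply; rewrite [X in (X < _)%E]mu_I01 ltry.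
Qed.

Lemma mu_cc (a b : F) : a <= b -> mu `[a, b]%classic = (b - a)%:E.
Proof.
move=> ab; rewrite lebesgue_measure_itv /= lte_fin; case: ltP => // ba.
by rewrite (_ : b - a = 0) //; apply/eqP; rewrite subr_eq0 eq_le ab ba.
Qed.

Lemma mu_oo (a b : F) : a <= b -> mu `]a, b[%classic = (b - a)%:E.
Proof.
move=> ab; rewrite lebesgue_measure_itv /= lte_fin; case: ltP => // ba.
by rewrite (_ : b - a = 0) //; apply/eqP; rewrite subr_eq0 eq_le ab ba.
Qed.

(** [A] and [B] lie in the closed intervals between their infimum and supremum, while [H] contains
    the open interval between the combined endpoints, since it contains combinations of points close
    to the ends. *)
Lemma brunn_minkowski_itv A B H (l : F) :
  A `<=` I01 -> B `<=` I01 -> H `<=` I01 ->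
  is_interval A -> is_interval B -> is_interval H ->
  A !=set0 -> B !=set0 -> 0 < l < 1 ->
  (forall x y, A x -> B y -> H (l * x + (1 - l) * y)) ->
  l * len A + (1 - l) * len B <= len H.
Proof.
move=> A01 B01 H01 iA iB iH A0 B0 /andP[l0 l1] ABH.
have bnd X : X `<=` I01 -> has_ubound X /\ has_lbound X.
  by move=> X01; split; [exists 1|exists 0] => x /X01 /I01P /andP[].
have le_len X : X `<=` I01 -> is_interval X -> X !=set0 ->
    len X <= sup X - inf X /\ inf X <= sup X.
  move=> X01 iX [x Xx]; have [ubX lbX] := bnd _ X01.
  have infsup : inf X <= sup X.
    by apply: (@le_trans _ _ x); [exact: ge_inf | exact: ub_le_sup].
  split=> //; have XS : X `<=` `[inf X, sup X].
    by move=> y Xy; rewrite /= in_itv /= ge_inf //= ub_le_sup.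
  have mX := is_interval_measurable iX.
  have le1 : (mu X <= (sup X - inf X)%:E)%E.
    rewrite -(mu_cc infsup); exact: (le_measure mu (mem_set mX) (mem_set (measurable_itv _)) XS).
  by rewrite -[leRHS]/(fine (sup X - inf X)%:E) fine_le // sub01_fin.
have [lenA infsupA] := le_len _ A01 iA A0.
have [lenB infsupB] := le_len _ B01 iB B0.
pose a := l * inf A + (1 - l) * inf B; pose b := l * sup A + (1 - l) * sup B.
have l1' : 0 < 1 - l by rewrite subr_gt0.
have ab_H : `]a, b[ `<=` H.
  move=> z; rewrite /= in_itv /= => /andP[az zb].
  have [ubA lbA] := bnd _ A01; have [ubB lbB] := bnd _ B01.
  pose e := z - a; have e0 : 0 < e by rewrite subr_gt0.
  have [x1 Ax1 x1e] := inf_adherent e0 (conj A0 lbA).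
  have [y1 By1 y1e] := inf_adherent e0 (conj B0 lbB).
  pose d := b - z; have d0 : 0 < d by rewrite subr_gt0.
  have [x2 Ax2 x2d] := sup_adherent d0 (conj A0 ubA).
  have [y2 By2 y2d] := sup_adherent d0 (conj B0 ubB).
  apply: (iH _ _ (ABH _ _ Ax1 By1) (ABH _ _ Ax2 By2)); apply/andP; split.
    have : l * x1 <= l * (inf A + e) by rewrite ler_wpM2l // ltW.
    have : (1 - l) * y1 <= (1 - l) * (inf B + e) by rewrite ler_wpM2l // ltW.
    by rewrite /e /a; lra.
  have : l * (sup A - d) <= l * x2 by rewrite ler_wpM2l // ltW.
  have : (1 - l) * (sup B - d) <= (1 - l) * y2 by rewrite ler_wpM2l // ltW.
  by rewrite /d /b; lra.
have ab : a <= b by rewrite lerD // ler_wpM2l // ltW.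
have lenH : b - a <= len H.
  have mH := is_interval_measurable iH.
  have le1 : ((b - a)%:E <= mu H)%E.
    rewrite -(mu_oo ab); exact: (le_measure mu (mem_set (measurable_itv _)) (mem_set mH) ab_H).
  by rewrite -[leLHS]/(fine (b - a)%:E) fine_le // sub01_fin.
apply: le_trans lenH.
have : l * len A <= l * (sup A - inf A) by rewrite ler_wpM2l // ltW.
have : (1 - l) * len B <= (1 - l) * (sup B - inf B) by rewrite ler_wpM2l // ltW.
by rewrite /a /b; lra.
Qed.

(** A discretised layer-cake formula: the sum is [d] times the number of multiples [k * d], [k < n],
    below [y]. The induction carries the sharper upper bound [min (y + d) (n * d)]. *)
Lemma staircase (d y : F) n : 0 < d -> 0 <= y ->
  Num.min y (n%:R * d) <= \sum_(k < n) d * ((k%:R * d < y)%R : nat)%:R <= y + d.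
Proof.
move=> d0 y0; suff : Num.min y (n%:R * d) <= \sum_(k < n) d * ((k%:R * d < y)%R : nat)%:R /\
    \sum_(k < n) d * ((k%:R * d < y)%R : nat)%:R <= Num.min (y + d) (n%:R * d).
  by move=> [-> /le_trans->] //; rewrite ge_min lexx.
elim: n => [|n [IH1 IH2]].
  by rewrite big_ord0 mul0r !ge_min !le_min lexx orbT andbT addr_ge0 // ltW.
rewrite big_ord_recr /= -natr1 mulrDl mul1r; move: IH1 IH2; rewrite !ge_min !le_min.
case: ltP => [ny|yn] /=; rewrite ?mulr1 ?mulr0 ?addr0.
  move=> /orP[H1|H1] /andP[H2 H3]; split; try (apply/orP; lra).
    by apply/andP; split; lra.
  by apply/andP; split; lra.
move=> /orP[H1|H1] /andP[H2 H3]; split; try (apply/orP; left; lra);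
  by apply/andP; split; lra.
Qed.

Section Layers.
Variables (f : F -> F) (d : F) (n : nat).
Hypotheses (fa : admissible f) (d_gt0 : 0 < d).

Let stair x := \sum_(k < n) d * \1_(level f (k%:R * d)) x.

Let mlevel t : measurable (level f t).
Proof.
have [mf _] := fa; have := mf (measurable_itv _) `]t, +oo[%classic (measurable_itv _).
rewrite (_ : _ `&` _ = level f t) //.
by congr (_ `&` _); rewrite predeqE => x /=; rewrite in_itv /= andbT.
Qed.

Let stairE x : I01 x -> stair x = \sum_(k < n) d * ((k%:R * d < f x)%R : nat)%:R.
Proof.
move=> x01; apply: eq_bigr => k _; rewrite indicE; congr (_ * (nat_of_bool _)%:R).
apply/idP/idP => [|lt]; first by rewrite inE => -[].
by rewrite inE; split.
Qed.

Let stair_int : mu.-integrable I01 (EFin \o stair) /\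
  integral01 stair = d * \sum_(k < n) len (level f (k%:R * d)).
Proof.
have int1 t : mu.-integrable I01 (EFin \o (fun x => d * \1_(level f t) x)).
  apply: (bounded_integrable01 (M := d)) => [|x _].
    by apply: measurable_funM => //; exact: measurable_indic.
  rewrite ger0_norm ?mulr_ge0 ?(ltW d_gt0) //.
  by rewrite -[leRHS]mulr1 ler_wpM2l ?(ltW d_gt0) // indicE; case: (_ \in _).
have mI : measurable I01 by exact: measurable_itv.
rewrite /stair; have [si ->] := integral01_sum (index_enum 'I_n) (fun k : 'I_n => int1 (k%:R * d)).
split=> //; rewrite mulr_sumr; apply: eq_bigr => k _.
rewrite /integral01 RintegralZl //; last first.
  apply: (bounded_integrable01 (M := 1)) => [|x _]; first exact: measurable_indic.
  by rewrite indicE ger0_norm //; case: (_ \in _).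
congr (_ * _); transitivity (fine (mu (level f (k%:R * d) `&` I01))).
  by rewrite /Rintegral integral_indic //; exact: mlevel.
by rewrite /level setIAC setIid.
Qed.

Lemma layer_upper : d * \sum_(k < n) len (level f (k%:R * d)) <= integral01 f + d.
Proof.
have [si <-] := stair_int; have fi := admissible_integrable fa.
have ci : mu.-integrable I01 (EFin \o (fun=> d)).
  by apply: (bounded_integrable01 (M := `|d|)) => //; exact: measurable_cst.
rewrite -[X in _ + X](integral01_cst d) -RintegralD //.
apply: le_Rintegral => //.
  exact: integrable01D.
move=> x x01; rewrite stairE //; have [_ /(_ x x01)/andP[f0 _]] := fa.
by have /andP[] := staircase n d_gt0 f0.
Qed.

Lemma layer_lower : (forall x, I01 x -> f x <= n%:R * d) ->
  integral01 f <= d * \sum_(k < n) len (level f (k%:R * d)).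
Proof.
move=> fn; have [si <-] := stair_int; have fi := admissible_integrable fa.
apply: le_Rintegral => // x x01; rewrite stairE //.
have [_ /(_ x x01)/andP[f0 _]] := fa.
have /andP[+ _] := staircase n d_gt0 f0; apply: le_trans.
by rewrite le_min lexx fn.
Qed.

End Layers.

(** With [m] the weighted mean, [ln u <= u - 1] is applied at [a / m] and [b / m]; the two
    right-hand sides average to zero. *)
Lemma powR_AGM (l a b : F) : 0 < l < 1 -> 0 <= a -> 0 <= b ->
  a `^ l * b `^ (1 - l) <= l * a + (1 - l) * b.
Proof.
move=> /andP[l0 l1]; have l1' : 0 < 1 - l by rewrite subr_gt0.
rewrite le_eqVlt => /predU1P[<-|a0].
  by rewrite powR0 ?gt_eqF // mul0r => b0; rewrite mulr0 add0r mulr_ge0 // ltW.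
rewrite le_eqVlt => /predU1P[<-|b0].
  by rewrite powR0 ?gt_eqF // !mulr0 addr0 mulr_ge0 // ltW.
pose m := l * a + (1 - l) * b; have m0 : 0 < m by rewrite addr_gt0 // mulr_gt0.
have ln_le x : 0 < x -> ln (x / m) <= x / m - 1.
  move=> x0; have xm : 0 < x / m by rewrite divr_gt0.
  by have := expR_ge1Dx (ln (x / m)); rewrite lnK ?posrE //; lra.
have := ln_le _ a0; have := ln_le _ b0; rewrite !ln_div ?posrE // => lb la.
rewrite -[leRHS](@lnK _ m) ?posrE // /powR !gt_eqF // -expRD ler_expR.
have : l * (ln a - ln m) + (1 - l) * (ln b - ln m) <= 0.
  have : l * (ln a - ln m) <= l * (a / m - 1) by rewrite ler_wpM2l // ltW.
  have : (1 - l) * (ln b - ln m) <= (1 - l) * (b / m - 1) by rewrite ler_wpM2l // ltW.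
  have : l * (a / m - 1) + (1 - l) * (b / m - 1) = 0.
    by rewrite /m; field; rewrite gt_eqF.
  by lra.
by lra.
Qed.

Lemma le_archi (a b c : F) : 0 <= c ->
  (forall n : nat, a <= b + c / n.+1%:R) -> a <= b.
Proof.
move=> c0 H; rewrite leNgt; apply/negP => ba.
have e0 : 0 < a - b by rewrite subr_gt0.
pose n := Num.bound (c / (a - b)).
have := archi_boundP (divr_ge0 c0 (ltW e0)); rewrite -/n ltr_pdivrMr // => cn.
have := H n; rewrite -lerBlDl ler_pdivlMr ?ltr0n // mulrC => le1.
have : n%:R * (a - b) <= n.+1%:R * (a - b) by rewrite ler_wpM2r ?(ltW e0) // ler_nat.
by move=> /(lt_le_trans cn) /lt_le_trans /(_ le1); rewrite ltxx.
Qed.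

(* The superlevel sets at heights proportional to the suprema [a], [b] and to
  [a `^ l * b `^ (1 - l)] are intervals to which [brunn_minkowski_itv] applies;
  summing their lengths over a fine scale of heights approximates the integrals. *)
Lemma prekopa_leindler01 f g h (l : F) : 0 < l < 1 ->
  admissible f -> admissible g -> admissible h ->
  quasiconcave f -> quasiconcave g -> quasiconcave h ->
  (forall x y, I01 x -> I01 y -> f x `^ l * g y `^ (1 - l) <= h (l * x + (1 - l) * y)) ->
  integral01 f `^ l * integral01 g `^ (1 - l) <= integral01 h.
Proof.
move=> l01 fa ga ha qf qg qh fgh; have [/andP[l0 l1]] := l01.
have l1' : 0 < 1 - l by rewrite subr_gt0.
have I0 : I01 0 by apply/I01P; rewrite lexx ler01.
have supP u : admissible u -> [/\ 0 <= sup (u @` I01), forall x, I01 x -> u x <= sup (u @` I01)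
    & has_sup (u @` I01)].
  move=> [_ u01]; have hs : has_sup (u @` I01).
    by split; [exists (u 0); exists 0 | exists 1 => _ [x /u01 /andP[_ ?] <-]].
  have ub x : I01 x -> u x <= sup (u @` I01).
    by move=> x01; apply: ub_le_sup; [exact: hs.2 | exists x].
  split=> //; apply: le_trans (ub _ I0).
  by have /andP[] := u01 _ I0.
have int0 u : admissible u -> sup (u @` I01) = 0 -> integral01 u = 0.
  move=> ua; have [_ uub _] := supP u ua => s0; apply/eqP; rewrite eq_le.
  have /andP[-> _] := integral01_itv ua; rewrite andbT -[leRHS](integral01_cst 0).
  have za : admissible (fun=> 0).
    by split=> [|x _]; [exact: measurable_cst | rewrite lexx ler01].
  by apply: le_integral01 => // x x01; rewrite -s0 uub.
have /andP[Ih0 _] := integral01_itv ha.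
have [a0 fle hsf] := supP f fa; have [b0 gle hsg] := supP g ga.
move: a0; rewrite le_eqVlt => /predU1P[/esym/(int0 _ fa)->|a0].
  by rewrite powR0 ?mul0r // gt_eqF.
move: b0; rewrite le_eqVlt => /predU1P[/esym/(int0 _ ga)->|b0].
  by rewrite powR0 ?mulr0 // gt_eqF.
set a := sup (f @` I01) in a0 fle hsf *; set b := sup (g @` I01) in b0 gle hsg *.
pose c := a `^ l * b `^ (1 - l).
have c0 : 0 < c by rewrite mulr_gt0 // powR_gt0.
have /andP[If0 _] := integral01_itv fa; have /andP[Ig0 _] := integral01_itv ga.
pose m := l * (integral01 f / a) + (1 - l) * (integral01 g / b).
(* Divided by [a] and [b], both functions have supremum [1]; for such functions the additive
   inequality holds, with the arithmetic mean [m], and AM-GM recovers the multiplicative form. *)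
apply: (@le_trans _ _ (c * m)).
  have -> : integral01 f `^ l * integral01 g `^ (1 - l) =
      c * ((integral01 f / a) `^ l * (integral01 g / b) `^ (1 - l)).
    rewrite /c mulrACA -!powRM ?divr_ge0 ?(ltW a0) ?(ltW b0) //.
    by rewrite ![_ * (_ / _)]mulrC !divfK ?gt_eqF.
  by rewrite ler_wpM2l ?(ltW c0) // powR_AGM // divr_ge0 // ltW.
(* The staircase below [h] has steps of height [c / N]; [layer_upper] loses one step, and [le_archi]
   removes this error. *)
apply: (le_archi (ltW c0)) => n; pose N : F := n.+1%:R.
have N0 : 0 < N by rewrite ltr0n.
have dl z : 0 < z -> 0 < z / N by move=> z0; rewrite divr_gt0.
have := layer_upper n.+1 ha (dl _ c0); apply: le_trans.
have Nz z : n.+1%:R * (z / N) = z by rewrite mulrC divfK // gt_eqF.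
have := layer_lower (n := n.+1) fa (dl _ a0); rewrite Nz => /(_ fle) lowf.
have := layer_lower (n := n.+1) ga (dl _ b0); rewrite Nz => /(_ gle) lowg.
set Sf := \sum_(k < _) _ in lowf; set Sg := \sum_(k < _) _ in lowg.
set Sh := \sum_(k < _) _.
have scaleE q : 0 <= q -> q * c = (q * a) `^ l * (q * b) `^ (1 - l).
  move=> q0; rewrite !powRM ?(ltW a0) ?(ltW b0) // mulrACA; congr (_ * _).
  by rewrite -powRD ?(addrC l) ?subrK ?oner_eq0 // powRr1.
have SS : l * Sf + (1 - l) * Sg <= Sh.
  rewrite /Sf /Sg /Sh !mulr_sumr -big_split; apply: ler_sum => k _ /=.
  (* The heights stay strictly below the suprema, so the levels of [f] and [g] are nonempty, as
     [brunn_minkowski_itv] requires. *)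
  have kN : k%:R / N < 1 by rewrite ltr_pdivrMr // mul1r ltr_nat.
  have kN0 : 0 <= k%:R / N by rewrite divr_ge0 // ltW.
  have kz z : k%:R * (z / N) = k%:R / N * z by rewrite mulrA mulrAC.
  have ne u : has_sup (u @` I01) -> 0 < sup (u @` I01) ->
      level u (k%:R * (sup (u @` I01) / N)) !=set0.
    move=> hs s0; have e0 : 0 < sup (u @` I01) - k%:R * (sup (u @` I01) / N).
      by rewrite subr_gt0 kz -[ltRHS]mul1r ltr_pM2r.
    have [_ [x x01 <-]] := sup_adherent e0 hs.
    by rewrite opprB addrCA subrr addr0 => ux; exists x.
  apply: brunn_minkowski_itv => //; try (by move=> x []); try exact: ne.
  move=> x y [x01 fx] [y01 gy]; split.
    have /I01P/andP[x0 x1] := x01; have /I01P/andP[y0 y1] := y01.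
    by apply/I01P; apply/andP; split; nra.
  apply: lt_le_trans (fgh _ _ x01 y01); move: fx gy; rewrite /= !kz => fx gy.
  rewrite (scaleE _ kN0).
  have ka0 : 0 <= k%:R / N * a by rewrite mulr_ge0 // ltW.
  have kb0 : 0 <= k%:R / N * b by rewrite mulr_ge0 // ltW.
  apply: ltr_pM; rewrite ?powR_ge0 //; apply: gt0_ltr_powR; rewrite ?nnegrE //.
    by apply: le_trans ka0 (ltW fx).
  by apply: le_trans kb0 (ltW gy).
have scale_le z u S : 0 < z -> u <= z / N * S -> u / z * N <= S.
  move=> z0 uS; rewrite -(ler_pM2l (dl _ z0)); apply: le_trans uS.
  by apply: eq_leW; field; rewrite !gt_eqF.
have lf := scale_le _ _ _ a0 lowf; have lg := scale_le _ _ _ b0 lowg.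
have -> : c * m = c / N * (l * (integral01 f / a * N) + (1 - l) * (integral01 g / b * N)).
  by rewrite /m; field; rewrite !gt_eqF.
rewrite ler_wpM2l ?(ltW (dl _ c0)) //; apply: le_trans SS.
by rewrite lerD // ler_wpM2l // ltW.
Qed.

End UnitInterval.

(** * Iterated integrals and marginals of log-concave functions *)

Section IteratedIntegral.
Variables (F : realType) (W : finType) (U : {pred W}).
Implicit Types (f g : (W -> F) -> F) (z : W -> F) (es : seq W).

Local Notation mu := (@lebesgue_measure F).
Local Notation I01 := (`[0%R, 1%R]%classic : set F).

Definition upd z e (u : F) : W -> F := fun w => if w == e then u else z w.

Fixpoint iint es f z : F :=
  if es is e :: es' then integral01 (fun u => iint es' f (upd z e u)) else f z.

(** Coordinates outside [U] are free reals; they will hold the exponents. *)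
Definition dom z := forall w, w \in U -> 0 <= z w <= 1.

Definition convz (l : F) z1 z2 : W -> F := fun w => l * z1 w + (1 - l) * z2 w.

Lemma dom_upd z e u : dom z -> I01 u -> dom (upd z e u).
Proof. by move=> zU /I01P u01 w wU; rewrite /upd; case: eqP => // _; exact: zU. Qed.

Lemma convz01 (l x y : F) : 0 < l < 1 -> 0 <= x <= 1 -> 0 <= y <= 1 ->
  0 <= l * x + (1 - l) * y <= 1.
Proof. by move=> /andP[l0 l1] /andP[x0 x1] /andP[y0 y1]; apply/andP; split; nra. Qed.

Lemma dom_convz l z1 z2 : 0 < l < 1 -> dom z1 -> dom z2 -> dom (convz l z1 z2).
Proof. by move=> l01 d1 d2 w wU; apply: convz01 => //; [exact: d1 | exact: d2]. Qed.

Lemma upd_convz l z1 z2 e u v :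
  upd (convz l z1 z2) e (l * u + (1 - l) * v) = convz l (upd z1 e u) (upd z2 e v).
Proof. by apply/funext => w; rewrite /upd /convz; case: eqP. Qed.

Definition logconcave f := (forall z, dom z -> 0 <= f z <= 1) /\
  forall l z1 z2, 0 < l < 1 -> dom z1 -> dom z2 ->
    f z1 `^ l * f z2 `^ (1 - l) <= f (convz l z1 z2).

(** Superlevel sets of a log-concave slice are intervals. Measurability comes from this, which
    matters for the capacity, an infimum over an uncountable family. *)
Lemma logconcave_slice f e z : logconcave f -> dom z ->
  admissible (fun u => f (upd z e u)) /\ quasiconcave (fun u => f (upd z e u)).
Proof.
move=> [f01 flc] zd.
have range u : I01 u -> 0 <= f (upd z e u) <= 1 by move=> u01; exact/f01/dom_upd.
suff qf : quasiconcave (fun u => f (upd z e u)).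
  by split=> //; split=> //; exact: quasiconcave_measurable.
move=> t x y [x01 fx] [y01 fy] v /andP[].
rewrite le_eqVlt => /predU1P[<- _|xv]; first by split.
rewrite le_eqVlt => /predU1P[->|vy]; first by split.
have xy : 0 < y - x by rewrite subr_gt0 (lt_trans xv).
pose l := (y - v) / (y - x).
have l0 : 0 < l by rewrite divr_gt0 // subr_gt0.
have l1 : l < 1 by rewrite ltr_pdivrMr // mul1r ltrD2l ltrN2.
have vE : v = l * x + (1 - l) * y by rewrite /l; field; rewrite gt_eqF.
have l01 : 0 < l < 1 by rewrite l0.
have v01 : I01 v.
  by rewrite vE; apply/I01P; apply: (convz01 l01); exact/I01P.
(* A negative level is exceeded everywhere because [f] is nonnegative; the powers of [t] below need
   [0 <= t]. *)
split=> //=; have [t0|t0] := ltP t 0.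
  by have /andP[] := range _ v01; move=> /(lt_le_trans t0).
have zz : convz l z z = z by apply/funext => w; rewrite /convz; ring.
have := flc l _ _ l01 (dom_upd e zd x01) (dom_upd e zd y01).
rewrite -upd_convz zz -vE; apply: lt_le_trans.
have -> : t = t `^ l * t `^ (1 - l).
  by rewrite -powRD ?(addrC l) ?subrK ?oner_eq0 // powRr1.
have l1' : 0 < 1 - l by rewrite subr_gt0.
apply: ltr_pM; rewrite ?powR_ge0 //; apply: gt0_ltr_powR; rewrite ?nnegrE //.
  exact: le_trans (ltW fx).
exact: le_trans (ltW fy).
Qed.

(** Prekopa-Leindler for the slices at [z1], at [z2] and at their combination. The property
    reproduces itself, so coordinates can be integrated one after the other. *)
Lemma logconcave_integral f e : logconcave f ->
  logconcave (fun z => integral01 (fun u => f (upd z e u))).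
Proof.
move=> fl; have slice z := @logconcave_slice f e z fl.
split=> [z /slice[fa _]|l z1 z2 l01 d1 d2]; first exact: integral01_itv.
have [a1 q1] := slice _ d1; have [a2 q2] := slice _ d2.
have [a3 q3] := slice _ (dom_convz l01 d1 d2).
apply: prekopa_leindler01 => // x y x01 y01; rewrite upd_convz.
by have [_] := fl; apply=> //; exact: dom_upd.
Qed.

Lemma logconcave_iint es f : logconcave f -> logconcave (iint es f).
Proof. by move=> fl; elim: es => //= e es IH; exact: logconcave_integral. Qed.

(** Kept apart from [logconcave] since the comparison also involves [tabfun], whose integrability
    comes from [iint_prod]. *)
Fixpoint iintegrable es f : Prop :=
  if es is e :: es' then iintegrable es' f /\
    forall z, dom z -> mu.-integrable I01 (EFin \o (fun u => iint es' f (upd z e u)))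
  else True.

Lemma logconcave_iintegrable es f : logconcave f -> iintegrable es f.
Proof.
move=> fl; elim: es => //= e es IH; split=> // z zd.
apply: admissible_integrable.
by have [] := logconcave_slice e (logconcave_iint es fl) zd.
Qed.

(** [P] fixes coordinates that are not integrated; it will be [has_margins], outside of which
    [f <= g] is not known. *)
Lemma le_iint (P : (W -> F) -> Prop) es f g z :
  (forall z e u, e \in es -> P z -> P (upd z e u)) ->
  iintegrable es f -> iintegrable es g ->
  (forall z, dom z -> P z -> f z <= g z) -> dom z -> P z -> iint es f z <= iint es g z.
Proof.
move=> + + + fg; elim: es z => [|e es IH] z /=; first by move=> _ _ _; exact: fg.
move=> Pupd [fi fie] [gi gie] zd zP.
apply: le_Rintegral; [exact: measurable_itv|exact: fie|exact: gie|].
move=> u u01; apply: IH => //; [|exact: dom_upd|by apply: Pupd; rewrite ?mem_head].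
by move=> y d v des; apply: Pupd; rewrite inE des orbT.
Qed.

Lemma iintZ es f (k : F) : iintegrable es f ->
  iintegrable es (fun z => k * f z) /\
  forall z, dom z -> iint es (fun z => k * f z) z = k * iint es f z.
Proof.
elim: es => [|e es IH] //= [fi fie]; have [IHi IHE] := IH fi.
have slice z : dom z -> mu.-integrable I01 (EFin \o (fun u => k * iint es f (upd z e u))).
  move=> zd; rewrite (_ : _ \o _ = (fun u => k%:E * (iint es f (upd z e u))%:E)%E) //.
  by apply: integrableZl => //; exact: fie.
have sliceE z : dom z -> {in I01, (fun u => iint es (fun z => k * f z) (upd z e u)) =1
    (fun u => k * iint es f (upd z e u))}.
  by move=> zd u; rewrite inE => u01; rewrite IHE //; exact: dom_upd.
split; [split=> // z zd | move=> z zd].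
  apply: eq_integrable (slice z zd); first exact: measurable_itv.
  by move=> u u01; rewrite /= -sliceE.
rewrite /integral01 (@eq_Rintegral _ _ _ mu I01 (fun u => k * iint es f (upd z e u))).
  by apply: integral01Zl; exact: fie.
exact: sliceE.
Qed.

(** For finite sums of products of one-variable functions, linearity alone evaluates the iterated
    integral, without a product measure. *)
Lemma iint_prod (A : Type) (s : seq A) (phi : A -> W -> F -> F) es :
  (forall a w, mu.-integrable I01 (EFin \o phi a w)) -> uniq es ->
  iintegrable es (fun z => \sum_(a <- s) \prod_w phi a w (z w)) /\
  forall z, iint es (fun z => \sum_(a <- s) \prod_w phi a w (z w)) z =
    \sum_(a <- s) \prod_w (if w \in es then integral01 (phi a w) else phi a w (z w)).
Proof.
move=> phi_int; elim: es => [|e es IH] //= /andP[ees ues].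
have [IHi IHE] := IH ues.
pose c a z := \prod_(w | w != e) (if w \in es then integral01 (phi a w) else phi a w (z w)).
have sliceE z : (fun u => iint es (fun z => \sum_(a <- s) \prod_w phi a w (z w)) (upd z e u)) =
    (fun u => \sum_(a <- s) c a z * phi a e u).
  apply/funext => u; rewrite IHE; apply: eq_bigr => a _.
  rewrite (bigD1 e) //= (negPf ees) /upd eqxx mulrC; congr (_ * _).
  by apply: eq_bigr => w /negPf we; rewrite we.
have term_int a z : mu.-integrable I01 (EFin \o (fun u => c a z * phi a e u)).
  rewrite (_ : _ \o _ = (fun u => (c a z)%:E * (phi a e u)%:E)%E) //.
  by apply: integrableZl => //; exact: phi_int.
split; [split=> // z _ | move=> z].
  by rewrite sliceE; have [] := integral01_sum s (fun a => term_int a z).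
rewrite sliceE; have [_ ->] := integral01_sum s (fun a => term_int a z).
apply: eq_bigr => a _; rewrite integral01Zl //.
rewrite [RHS](bigD1 e) //= mem_head mulrC; congr (_ * _).
by apply: eq_bigr => w /negPf we; rewrite inE we.
Qed.

End IteratedIntegral.

(** * Capacity *)

Section GeometricMean.
Variables (F : realType) (l : F).

Definition gm_le (x1 x2 x : F) :=
  [/\ 0 <= x1, 0 <= x2 & x1 `^ l * x2 `^ (1 - l) <= x].

Lemma gm_le1 : gm_le 1 1 1.
Proof. by split; rewrite ?ler01 // !powR1 mulr1. Qed.

Lemma gm_leM x1 x2 x y1 y2 y : gm_le x1 x2 x -> gm_le y1 y2 y ->
  gm_le (x1 * y1) (x2 * y2) (x * y).
Proof.
move=> [x10 x20 xx] [y10 y20 yy]; split; rewrite ?mulr_ge0 //.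
by rewrite !powRM // mulrACA ler_pM // mulr_ge0 // powR_ge0.
Qed.

Lemma gm_leX x1 x2 x n : gm_le x1 x2 x -> gm_le (x1 ^+ n) (x2 ^+ n) (x ^+ n).
Proof.
move=> gx; elim: n => [|n IH]; first by rewrite !expr0; exact: gm_le1.
by rewrite !exprS; exact: gm_leM.
Qed.

Lemma gm_le_prod (I : finType) (x1 x2 x : I -> F) :
  (forall i, gm_le (x1 i) (x2 i) (x i)) ->
  gm_le (\prod_i x1 i) (\prod_i x2 i) (\prod_i x i).
Proof.
move=> gx; elim/big_rec3: _ => [|i y1 y2 y _]; first exact: gm_le1.
exact: gm_leM.
Qed.

Lemma gm_le_expR x y : gm_le (expR x) (expR y) (expR (l * x + (1 - l) * y)).
Proof.
split; rewrite ?expR_ge0 // -!expRM -expRD.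
by rewrite mulrC [y * _]mulrC.
Qed.

End GeometricMean.

Section Jensen.
Variables (F : realType) (W : finType) (U : {pred W}).

Lemma powR_prod (I : Type) (s : seq I) (a : I -> F) r :
  (forall i, 0 <= a i) -> (\prod_(i <- s) a i) `^ r = \prod_(i <- s) a i `^ r.
Proof.
move=> a0; elim: s => [|i s IH]; first by rewrite !big_nil powR1.
by rewrite !big_cons powRM ?IH // prodr_ge0.
Qed.

(** Induction on [p], with the other weights renormalised by their sum [b]. The cases [b = 0] and
    [a = 0] are separate because [logconcave] is stated for [0 < l < 1]. *)
Lemma logconcave_jensen p (alpha : 'I_p -> F) (z : 'I_p -> W -> F) f :
  logconcave U f -> (forall t, 0 <= alpha t) -> \sum_t alpha t = 1 ->
  (forall t, dom U (z t)) ->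
  dom U (fun w => \sum_t alpha t * z t w) /\
  \prod_t f (z t) `^ alpha t <= f (fun w => \sum_t alpha t * z t w).
Proof.
move=> [f01 flc]; elim: p alpha z => [|p IH] alpha z a0.
  by rewrite big_ord0 => /eqP; rewrite eq_sym oner_eq0.
rewrite big_ord_recl; set a := alpha ord0; set b := \sum_(i < p) _ => ab zd.
have b_ge0 : 0 <= b by exact: sumr_ge0.
have aE : a = 1 - b by rewrite -ab addrK.
have sumE w : \sum_t alpha t * z t w =
    a * z ord0 w + \sum_(i < p) alpha (lift ord0 i) * z (lift ord0 i) w.
  by rewrite big_ord_recl.
have [b0|b0] := eqVneq b 0.
  have ai0 i : alpha (lift ord0 i) = 0.
    by move/eqP: b0; rewrite psumr_eq0 // => /allP/(_ i (mem_index_enum i))/eqP.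
  have -> : (fun w => \sum_t alpha t * z t w) = z ord0.
    apply/funext => w; rewrite sumE aE b0 subr0 mul1r big1 ?addr0 // => i _.
    by rewrite ai0 mul0r.
  split=> //; rewrite big_ord_recl -/a aE b0 subr0 big1 => [|i _]; last by rewrite ai0 powRr0.
  by rewrite mulr1 powRr1 //; have /andP[] := f01 _ (zd ord0).
have b_gt0 : 0 < b by rewrite lt_def b0.
have := IH (fun i => alpha (lift ord0 i) / b) (fun i => z (lift ord0 i)).
have sum1 : \sum_i alpha (lift ord0 i) / b = 1 by rewrite -mulr_suml divff.
have ge0 i : 0 <= alpha (lift ord0 i) / b by rewrite divr_ge0.
set y := (fun w => \sum_t _) => /(_ ge0 sum1 (fun i => zd _)) [yd yf].
have bY w : b * y w = \sum_(i < p) alpha (lift ord0 i) * z (lift ord0 i) w.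
  by rewrite /y mulr_sumr; apply: eq_bigr => i _; field.
have fz0 i : 0 <= f (z i) by have /andP[] := f01 _ (zd i).
have prodE : (\prod_(i < p) f (z (lift ord0 i)) `^ (alpha (lift ord0 i) / b)) `^ b =
    \prod_(i < p) f (z (lift ord0 i)) `^ alpha (lift ord0 i).
  rewrite powR_prod => [|i]; last exact: powR_ge0.
  by apply: eq_bigr => i _; rewrite -powRrM divfK.
have y0 : 0 <= f y by have /andP[] := f01 _ yd.
have prod_le : \prod_(i < p) f (z (lift ord0 i)) `^ alpha (lift ord0 i) <= f y `^ b.
  rewrite -prodE ge0_ler_powR // nnegrE //.
  by apply: prodr_ge0 => i _; exact: powR_ge0.
rewrite big_ord_recl -/a.
have [az|az] := eqVneq a 0.
  have b1 : b = 1 by rewrite -ab az add0r.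
  have -> : (fun w => \sum_t alpha t * z t w) = y.
    by apply/funext => w; rewrite sumE az mul0r add0r -bY b1 mul1r.
  by rewrite az powRr0 mul1r; split=> //; move: prod_le; rewrite b1 powRr1.
have a01 : 0 < a < 1.
  by rewrite lt_def az a0 /= aE ltrBlDr ltrDl.
have -> : (fun w => \sum_t alpha t * z t w) = convz a (z ord0) y.
  by apply/funext => w; rewrite sumE /convz -bY aE opprB addrCA subrr addr0.
split; first exact: dom_convz.
apply: le_trans (flc _ _ _ a01 (zd ord0) yd).
rewrite ler_wpM2l ?powR_ge0 // (le_trans prod_le) //.
by rewrite aE opprB addrCA subrr addr0.
Qed.

End Jensen.

Section Capacity.
Variables (F : realType) (I J : finType) (K : {ffun I * J -> nat}).
Local Notation T := (I * J)%type.
Local Notation L := (I + J)%type.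
Local Notation W := (L + T)%type.
Local Notation mu := (@lebesgue_measure F).
Local Notation I01 := (`[0%R, 1%R]%classic : set F).

Definition cell_coords : {pred W} := [pred w | if w is inr _ then true else false].

Implicit Types (z : W -> F) (w : L -> F).

Definition cell z e : F := z (inr e).
Definition cocell z e : F := 1 - z (inr e).

Lemma cell_ge0 z : dom cell_coords z -> forall e, 0 <= cell z e.
Proof. by move=> zd e; have /andP[] := zd (inr e) isT. Qed.

Lemma cocell_ge0 z : dom cell_coords z -> forall e, 0 <= cocell z e.
Proof. by move=> zd e; rewrite subr_ge0; have /andP[] := zd (inr e) isT. Qed.

Lemma cell_cocell z e : cell z e + cocell z e = 1.
Proof. by rewrite /cocell addrCA subrr addr0. Qed.

(* A coordinate [inl l] of [z] carries the exponent of the variable [l], and a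
  coordinate [inr e] the mixing parameter [s_e]; the variables are [expR \o w]. *)
Definition capterm w z : F :=
  \prod_e biform (cell z) (cocell z) (fun l => expR (w l)) e ^+ K e *
  expR (- \sum_l z (inl l) * w l).

Definition capacity z : F := inf [set capterm w z | w in [set: L -> F]].

Lemma biform_ge0 (x : L -> F) z e : dom cell_coords z -> (forall l, 0 <= x l) ->
  0 <= biform (cell z) (cocell z) x e.
Proof.
by move=> zd x0; rewrite addr_ge0 // mulr_ge0 ?cell_ge0 ?cocell_ge0.
Qed.

Lemma capterm_ge0 w z : dom cell_coords z -> 0 <= capterm w z.
Proof.
move=> zd; rewrite mulr_ge0 ?expR_ge0 //; apply: prodr_ge0 => e _.
by rewrite exprn_ge0 // biform_ge0 // => l; exact: expR_ge0.
Qed.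

Lemma capacity_le w z : dom cell_coords z -> capacity z <= capterm w z.
Proof.
by move=> zd; apply: ge_inf; [exists 0 => _ [v _ <-]; exact: capterm_ge0 | exists w].
Qed.

Lemma capacity_ge (c : F) z : (forall w, c <= capterm w z) -> c <= capacity z.
Proof.
move=> cw; apply: lb_le_inf; first by exists (capterm (fun=> 0) z); exists (fun=> 0).
by move=> _ [w _ <-].
Qed.

(** At [x = 1] each linear form is [s + (1 - s)]. This bounds the capacity by [1]. *)
Lemma capterm0 z : capterm (fun=> 0) z = 1.
Proof.
rewrite /capterm [X in - X]big1 => [|l _]; last by rewrite mulr0.
rewrite oppr0 expR0 mulr1 big1 // => e _.
by rewrite /biform !mulr1 cell_cocell expr1n.
Qed.

(** A linear form is affine in its mixing parameter, hence log-concave by AM-GM; the monomial is the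
    exponential of a linear function of the exponents. *)
Lemma gm_capterm l w z1 z2 : 0 < l < 1 -> dom cell_coords z1 -> dom cell_coords z2 ->
  gm_le l (capterm w z1) (capterm w z2) (capterm w (convz l z1 z2)).
Proof.
move=> l01 d1 d2; apply: gm_leM.
  apply: gm_le_prod => e; apply: gm_leX; split.
  - by apply: biform_ge0 => // k; exact: expR_ge0.
  - by apply: biform_ge0 => // k; exact: expR_ge0.
  have b0 z : dom cell_coords z ->
      0 <= biform (cell z) (cocell z) (fun k => expR (w k)) e.
    by move=> zd; apply: biform_ge0 => // k; exact: expR_ge0.
  apply: le_trans (powR_AGM l01 (b0 _ d1) (b0 _ d2)) _.
  by apply: eq_leW;
    rewrite /biform /cocell /cell /convz; ring.
have := gm_le_expR l (- \sum_k z1 (inl k) * w k) (- \sum_k z2 (inl k) * w k).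
congr (gm_le _ _ _ (expR _)); rewrite !mulrN -opprD !mulr_sumr -big_split.
by congr (- _); apply: eq_bigr => k _; rewrite /convz /=; ring.
Qed.

Lemma logconcave_capacity : logconcave cell_coords capacity.
Proof.
split=> [z zd|l z1 z2 l01 d1 d2].
  apply/andP; split; first by apply: capacity_ge => w; exact: capterm_ge0.
  by rewrite -(capterm0 z); exact: capacity_le.
have cap0 z : dom cell_coords z -> 0 <= capacity z.
  by move=> zd; apply: capacity_ge => w; exact: capterm_ge0.
have /andP[l0 l1] := l01.
have l1' : 0 <= 1 - l by rewrite subr_ge0 ltW.
apply: capacity_ge => w; have [_ _] := gm_capterm w l01 d1 d2; apply: le_trans.
apply: ler_pM; rewrite ?powR_ge0 //; apply: ge0_ler_powR; rewrite ?nnegrE ?cap0 ?capterm_ge0 //.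
- exact: ltW.
- exact: capacity_le.
- exact: capacity_le.
Qed.

Variables (M : nat) (V : L -> nat).
Hypotheses (KM : forall e, (K e <= M)%N) (Vsum : (\sum_l V l = \sum_e K e)%N).

Definition tabfun z : F := \prod_e (K e)`!%:R * tabsum M (cell z) (cocell z) K V.

(** [tabfun] uses the fixed integer margins [V] whereas [capacity] reads real exponents from [z];
    this condition ties the two. *)
Definition has_margins z := forall l, z (inl l) = (V l)%:R.

Lemma capterm_margins w z : has_margins z ->
  capterm w z * \prod_l expR (w l) ^+ V l =
  \prod_e biform (cell z) (cocell z) (fun l => expR (w l)) e ^+ K e.
Proof.
move=> zV; rewrite /capterm -mulrA.
have -> : \prod_l expR (w l) ^+ V l = expR (\sum_l z (inl l) * w l).
  by rewrite expR_sum; apply: eq_bigr => l _; rewrite zV expRM_natl.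
by rewrite -expRD addNr expR0 mulr1.
Qed.

Lemma tabfun_lower z (n := (\sum_e K e)%N) : dom cell_coords z -> has_margins z ->
  capacity z * (n`!%:R * \prod_l (V l)%:R ^+ V l) <=
    \prod_l (V l)`!%:R * tabfun z * n%:R ^+ n.
Proof.
move=> zd zV; apply: tabsum_lower => // [e|e|x x0]; [exact: cell_ge0|exact: cocell_ge0|].
have := capacity_le (fun l => ln (x l)) zd.
have X0 : 0 < \prod_l x l ^+ V l by apply: prodr_gt0 => l _; rewrite exprn_gt0.
rewrite -(ler_pM2r X0) => /le_trans; apply.
have := capterm_margins (fun l => ln (x l)) zV.
have -> : \prod_l expR (ln (x l)) ^+ V l = \prod_l x l ^+ V l.
  by apply: eq_bigr => l _; rewrite lnK // posrE.
move=> ->; apply: eq_leW.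
by apply: eq_bigr => e _; rewrite /biform !lnK ?posrE.
Qed.

Lemma tabfun_upper z : dom cell_coords z -> has_margins z -> tabfun z <= capacity z.
Proof.
move=> zd zV; apply: capacity_ge => w.
have X0 : 0 < \prod_l expR (w l) ^+ V l by apply: prodr_gt0 => l _; rewrite exprn_gt0 ?expR_gt0.
rewrite -(ler_pM2r X0) capterm_margins //.
by apply: tabsum_upper => // *; rewrite ?expR_ge0 ?cell_ge0 ?cocell_ge0.
Qed.

Lemma tabfun_upper_row z : dom cell_coords z -> has_margins z ->
  tabfun z * (\prod_l (V l)`!%:R * \prod_e (K e)%:R ^+ K e) <=
  capacity z * (\prod_l (V l)%:R ^+ V l * \prod_e (K e)`!%:R).
Proof.
move=> zd zV; have V0 := @prod_natX_gt0 F L V; have Kf0 := @prodr_fact_gt0 F T K.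
have VK0 := mulr_gt0 V0 Kf0.
rewrite -ler_pdivrMr //; apply: capacity_ge => w; rewrite ler_pdivrMr //.
have X0 : 0 < \prod_l expR (w l) ^+ V l by apply: prodr_gt0 => l _; rewrite exprn_gt0 ?expR_gt0.
rewrite -(ler_pM2r X0) [capterm w z * _]mulrC -[leRHS]mulrA capterm_margins //.
have le1 := @tabsum_upper_row F I J M K V (cell z) (cocell z) KM Vsum (cell_ge0 zd)
  (cocell_ge0 zd) (fun l => expR (w l)) (cell_cocell z) (fun l => expR_gt0 (w l)).
rewrite -(ler_pM2l Kf0) in le1; rewrite /tabfun.
by apply: le_trans (le_trans le1 _); apply: eq_leW; ring.
Qed.

Definition cells : seq W := [seq inr e | e <- enum {: I * J}].

Definition cell_weight (A : {ffun T -> 'I_M.+1}) (w : W) (u : F) : F :=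
  if w is inr e then (K e)`!%:R * (dpow u (A e) * dpow (1 - u) (K e - A e)) else 1.

Lemma tabfunE : tabfun = fun z =>
  \sum_(A <- enum (istable K V)) \prod_w cell_weight A w (z w).
Proof.
apply/funext => z; rewrite big_enum /tabfun mulr_sumr; apply: eq_bigr => A _.
rewrite big_sumType /= [X in _ = X * _]big1 // mul1r -big_split.
by apply: eq_bigr.
Qed.

Lemma cell_weight_integrable A (c : W) : mu.-integrable I01 (EFin \o cell_weight A c).
Proof.
case: c => [l|e]; first by apply: (bounded_integrable01 (M := 1)) => [|x _];
  rewrite ?normr1 //; exact: measurable_cst.
pose c : F := (K e)`!%:R / (A e)`!%:R / (K e - A e)`!%:R.
rewrite (_ : _ \o _ = (fun u => c%:E * (XMonemX (A e) (K e - A e) u)%:E)%E); last first.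
  apply/funext => u; rewrite /= -EFinM /c /XMonemX /dpow /unstable.onem; congr EFin.
  by field; rewrite !fact_neq0.
by apply: integrableZl => //; exact: integrable_XMonemX.
Qed.

(** A beta integral, with the arguments of [beta_fun] one more than the exponents. The value does
    not depend on [A], which turns the integral of [tabfun] into a count. *)
Lemma integral_cell_weight (A : {ffun T -> 'I_M.+1}) e : (A e <= K e)%N ->
  integral01 (cell_weight A (inr e)) = (K e).+1%:R^-1.
Proof.
move=> AK; pose c : F := (K e)`!%:R / (A e)`!%:R / (K e - A e)`!%:R.
rewrite (_ : cell_weight A (inr e) = (fun u => c * XMonemX (A e) (K e - A e) u)); last first.
  apply/funext => u; rewrite /= /c /XMonemX /dpow /unstable.onem.
  by field; rewrite !fact_neq0.
rewrite integral01Zl; last exact: integrable_XMonemX.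
have -> : integral01 (XMonemX (A e) (K e - A e)) = beta_fun (A e).+1 (K e - A e).+1 :> F.
  by rewrite /beta_fun /integral01 Rintegral_mkcond.
rewrite beta_fun_fact subnKC // factS !natrM /c.
by field; rewrite !fact_neq0 /= gt_eqF // ltr_wpDr ?ler0n.
Qed.

Lemma iint_tabfun z :
  iint cells tabfun z = #|[pred A : {ffun T -> 'I_M.+1} | istable K V A]|%:R / \prod_e (K e).+1%:R
  /\ iintegrable cell_coords cells tabfun.
Proof.
have uc : uniq cells by rewrite map_inj_uniq ?enum_uniq // => e f [].
have [ii ie] := iint_prod cell_coords (enum (istable K V)) cell_weight_integrable uc.
rewrite tabfunE; split=> //; rewrite ie big_enum /=.
have cell_mem e : inr e \in cells by apply: map_f; rewrite mem_enum.
have cell_nmem l : inl l \notin cells by apply/mapP => -[].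
transitivity (\sum_(A in istable (M := M) K V) (\prod_e (K e).+1%:R : F)^-1).
  apply: eq_bigr => A /istableP[AK _ _]; rewrite big_sumType /= big1 ?mul1r; last first.
    by move=> l _; rewrite (negPf (cell_nmem l)).
  rewrite -prodfV; apply: eq_bigr => e _.
  by rewrite cell_mem integral_cell_weight.
by rewrite sumr_const -[LHS]mulr_natl; congr (_%:R * _); exact: eq_card.
Qed.

Lemma has_margins_upd z c u : c \in cells -> has_margins z -> has_margins (upd z c u).
Proof. by move=> /mapP[e _ ->] zV l; rewrite /upd /=. Qed.

Lemma capacity_iintegrable k : iintegrable cell_coords cells (fun z => k * capacity z).
Proof. by have [] := iintZ k (logconcave_iintegrable cells logconcave_capacity). Qed.

Lemma iint_capacityZ k z : dom cell_coords z ->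
  iint cells (fun z => k * capacity z) z = k * iint cells capacity z.
Proof. by have [_] := iintZ k (logconcave_iintegrable cells logconcave_capacity); apply. Qed.

Lemma iint_tabfun_le k z : dom cell_coords z -> has_margins z ->
  (forall y, dom cell_coords y -> has_margins y -> tabfun y <= k * capacity y) ->
  iint cells tabfun z <= k * iint cells capacity z.
Proof.
move=> zd zV H; rewrite -iint_capacityZ //.
have [_ ti] := iint_tabfun z.
by apply: (le_iint (P := has_margins)) ti (capacity_iintegrable k) H zd zV => *;
  exact: has_margins_upd.
Qed.

Lemma iint_tabfun_ge k z : dom cell_coords z -> has_margins z ->
  (forall y, dom cell_coords y -> has_margins y -> k * capacity y <= tabfun y) ->
  k * iint cells capacity z <= iint cells tabfun z.
Proof.
move=> zd zV H; rewrite -iint_capacityZ //.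
have [_ ti] := iint_tabfun z.
by apply: (le_iint (P := has_margins)) (capacity_iintegrable k) ti H zd zV => *;
  exact: has_margins_upd.
Qed.

(** [Omega] over an arbitrary finite index type, as the margins are indexed by rows and columns
    together. *)
Definition weight (S : finType) (v : S -> nat) : F := \prod_l dpow (v l)%:R (v l).

Lemma weightE (S : finType) (v : S -> nat) :
  weight v = \prod_l (v l)%:R ^+ v l / \prod_l (v l)`!%:R.
Proof. exact: prodf_div. Qed.

Lemma weight_gt0 (S : finType) (v : S -> nat) : 0 < weight v.
Proof. by rewrite weightE divr_gt0 ?prod_natX_gt0 ?prodr_fact_gt0. Qed.

(** Each branch of the minimum has its own pointwise bound: [tabfun_upper] when it is [weight K],
    [tabfun_upper_row] when it is [weight V]. *)
Lemma tables_upper z : dom cell_coords z -> has_margins z ->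
  iint cells tabfun z / Num.min (weight V) (weight K) <= iint cells capacity z / weight K.
Proof.
move=> zd zV; have WV0 := weight_gt0 V; have WK0 := weight_gt0 K.
rewrite ler_pdivrMr ?lt_min ?WV0 // -mulrA mulrC.
apply: iint_tabfun_le => // y yd yV; rewrite /Num.min; case: ifP => _; last first.
  by rewrite mulVf ?gt_eqF // mul1r; exact: tabfun_upper.
have VF0 := @prodr_fact_gt0 F L V; have KN0 := @prod_natX_gt0 F T K.
have KF0 := @prodr_fact_gt0 F T K.
rewrite -(ler_pM2r (mulr_gt0 VF0 KN0)); apply: le_trans (tabfun_upper_row yd yV) _.
apply: eq_leW; rewrite !weightE.
by field; rewrite !gt_eqF.
Qed.

Lemma tables_lower z (n := (\sum_e K e)%N) : dom cell_coords z -> has_margins z ->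
  iint cells capacity z <= dpow n%:R n * iint cells tabfun z / weight V.
Proof.
move=> zd zV; have WV0 := weight_gt0 V.
have n0 : 0 < dpow n%:R n :> F by rewrite divr_gt0 ?natX_gt0 ?factr_gt0.
rewrite ler_pdivlMr // -ler_pdivrMl //.
have -> (d c : F) : d^-1 * (c * weight V) = weight V / d * c.
  by rewrite mulrCA mulrC [d^-1 * _]mulrC.
have VF0 := @prodr_fact_gt0 F L V; have nN0 := natX_gt0 F n; have nF0 := factr_gt0 F n.
apply: iint_tabfun_ge => // y yd yV.
rewrite -(ler_pM2r (mulr_gt0 VF0 nN0)); apply: le_trans (le_trans (tabfun_lower yd yV) _).
  apply: eq_leW; rewrite weightE /dpow -/n.
  by field; rewrite !gt_eqF.
by apply: eq_leW; rewrite -/n; ring.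
Qed.

End Capacity.

Local Close Scope classical_set_scope.

(** * The theorem *)

Section Tables.
Variables (F : realType) (m n : nat) (K : 'M[nat]_(m, n)).
Local Notation T := ('I_m * 'I_n)%type.
Local Notation L := ('I_m + 'I_n)%type.
Local Notation M := (entry_sum K).

Definition cap_ffun : {ffun T -> nat} := [ffun e => K e.1 e.2].

Definition margins (R : 'rV[nat]_m) (C : 'rV[nat]_n) (l : L) : nat :=
  match l with inl i => R ord0 i | inr j => slack K C ord0 j end.

Lemma cap_ffun_sum : (\sum_e cap_ffun e = entry_sum K)%N.
Proof.
rewrite /entry_sum pair_bigA /=; apply: eq_bigr => e _.
by rewrite ffunE.
Qed.

Lemma cap_ffun_le e : (cap_ffun e <= M)%N.
Proof. by rewrite -cap_ffun_sum (bigD1 e) //= leq_addr. Qed.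

(** For [A <= K] the column sums of [K - A] are differences of column sums; since [C <= colsum K],
    the truncated subtraction loses nothing and equal slacks mean equal column sums. *)
Lemma ntablesE (R : 'rV[nat]_m) (C : 'rV[nat]_n) :
  (forall j, (C ord0 j <= colsum K ord0 j)%N) ->
  ntables K R C =
    #|[pred A : {ffun T -> 'I_M.+1} | istable cap_ffun (margins R C) A]|.
Proof.
move=> CK; pose g (A : {ffun T -> 'I_M.+1}) : 'M[nat]_(m, n) :=
  \matrix_(i, j) (A (i, j) : nat).
have g_inj : injective g.
  by move=> A B /matrixP AB; apply/ffunP => -[i j]; apply/val_inj; have := AB i j; rewrite !mxE.
have tabE A : istable cap_ffun (margins R C) A <-> tables K R C (g A).
  have sumE j : (forall e, (A e <= cap_ffun e)%N) ->
      (\sum_i (cap_ffun (i, j) - A (i, j)) = \sum_i K i j - \sum_i A (i, j))%N.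
    move=> h; rewrite sumnB => [|i _]; last exact: h.
    by congr (_ - _)%N; apply: eq_bigr => i _; rewrite ffunE.
  split=> [/istableP[h1 h2 h3]|[h1 h2 h3]].
    split=> [i|j|i j].
    - by rewrite -[RHS]h2; apply: eq_bigr => j _; rewrite mxE.
    - have := h3 j; rewrite sumE //= !mxE => eqs.
      have := CK j; rewrite mxE => CKj.
      have AK : (\sum_i A (i, j) <= \sum_i K i j)%N.
        by apply: leq_sum => i _; have := h1 (i, j); rewrite ffunE.
      have -> : (\sum_i g A i j = \sum_i A (i, j))%N by apply: eq_bigr => i _; rewrite mxE.
      by rewrite -(subKn CKj) -eqs subKn.
    - by have := h1 (i, j); rewrite mxE ffunE.
  have h1' e : (A e <= cap_ffun e)%N by case: e => i j; have := h3 i j; rewrite mxE ffunE.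
  apply/istableP; split=> [//|i|j].
    by rewrite /= -h1; apply: eq_bigr => j _; rewrite mxE.
  rewrite sumE //= !mxE; congr (_ - _)%N.
  by rewrite -h2; apply: eq_bigr => i _; rewrite mxE.
pose P := [pred A : {ffun T -> 'I_M.+1} | istable cap_ffun (margins R C) A].
have <- : #|` [fset g A | A in P]%fset| = #|P| by rewrite card_imfset //= cardE.
congr (#|` _|); apply/fsetP => B; rewrite in_fset_set; last exact: tables_finite.
apply/idP/imfsetP => [|[A]].
  rewrite inE => tB; have [_ _ BK] := tB.
  pose A : {ffun T -> 'I_M.+1} := [ffun e => inord (B e.1 e.2)].
  have gA : g A = B.
    apply/matrixP => i j; rewrite mxE ffunE inordK // ltnS (leq_trans (BK i j)) //.
    by have := cap_ffun_le (i, j); rewrite ffunE.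
  by exists A => //; apply/tabE; rewrite gA.
by move=> /tabE tA ->; rewrite inE.
Qed.

Lemma weight_margins (R : 'rV[nat]_m) (C : 'rV[nat]_n) :
  weight F (margins R C) = Omega F R * Omega F (slack K C).
Proof. by rewrite /weight big_sumType /Omega !big_ord1. Qed.

Lemma weight_cap : weight F cap_ffun = Omega F K.
Proof.
rewrite /weight /Omega pair_bigA /=; apply: eq_bigr => e _.
by rewrite ffunE.
Qed.

(** Degree balance: [|R| + (|K| - |C|) = |K|]. *)
Lemma margins_sum (R : 'rV[nat]_m) (C : 'rV[nat]_n) :
  (forall j, (C ord0 j <= colsum K ord0 j)%N) -> entry_sum R = entry_sum C ->
  (\sum_l margins R C l = \sum_e cap_ffun e)%N.
Proof.
move=> CK; rewrite /entry_sum !big_ord1 => RC; rewrite big_sumType /= RC.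
have -> : (\sum_j slack K C ord0 j = \sum_j colsum K ord0 j - \sum_j C ord0 j)%N.
  rewrite -sumnB => [|j _]; last exact: CK.
  by apply: eq_bigr => j _; rewrite mxE.
rewrite subnKC ?leq_sum // cap_ffun_sum /entry_sum exchange_big /=.
by apply: eq_bigr => j _; rewrite mxE.
Qed.

End Tables.

Theorem theorem1 (F : realType) (m n p : nat)
    (m_ge1 : (1 <= m)%N) (n_ge1 : (1 <= n)%N) (p_ge1 : (1 <= p)%N)
    (alpha : 'I_p -> F)
    (alpha_ge0 : forall t, 0 <= alpha t)
    (alpha_sum1 : \sum_(t < p) alpha t = 1)
    (Rs : 'I_p -> 'rV[nat]_m) (Cs : 'I_p -> 'rV[nat]_n) (N : nat)
    (sum_Rs : forall t, entry_sum (Rs t) = N)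
    (sum_Cs : forall t, entry_sum (Cs t) = N)
    (K : 'M[nat]_(m, n))
    (Cs_le : forall t j, (Cs t ord0 j <= \sum_(i < m) K i j)%N)
    (R : 'rV[nat]_m) (C : 'rV[nat]_n)
    (R_def : natr_mx F R = \sum_(t < p) alpha t *: natr_mx F (Rs t))
    (C_def : natr_mx F C = \sum_(t < p) alpha t *: natr_mx F (Cs t)) :
  omega F (entry_sum K) * (ntables K R C)%:R
    / (Omega F R * Omega F (slack K C) * Omega F K)
  >= \prod_(t < p)
       ((ntables K (Rs t) (Cs t))%:R
        / Num.min (Omega F (Rs t) * Omega F (slack K (Cs t))) (Omega F K))
       `^ alpha t.
Proof.
have RE i : (R ord0 i)%:R = \sum_t alpha t * (Rs t ord0 i)%:R.
  by have /matrixP/(_ ord0 i) := R_def; rewrite mxE summxE => ->;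
    apply: eq_bigr => t _; rewrite !mxE.
have CE j : (C ord0 j)%:R = \sum_t alpha t * (Cs t ord0 j)%:R.
  by have /matrixP/(_ ord0 j) := C_def; rewrite mxE summxE => ->;
    apply: eq_bigr => t _; rewrite !mxE.
have avg (x : F) : \sum_t alpha t * x = x by rewrite -mulr_suml alpha_sum1 mul1r.
have sumE q (v : 'rV[nat]_q) (vs : 'I_p -> 'rV[nat]_q) :
    (forall t, entry_sum (vs t) = N) ->
    (forall i, (v ord0 i)%:R = \sum_t alpha t * (vs t ord0 i)%:R :> F) -> entry_sum v = N.
  move=> vsN vE; apply/eqP; rewrite -(eqr_nat F) /entry_sum big_ord1 natr_sum.
  rewrite (eq_bigr _ (fun i _ => vE i)) exchange_big /= -{1}(avg N%:R); apply/eqP.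
  apply: eq_bigr => t _; rewrite -mulr_sumr -natr_sum; congr (_ * _%:R).
  by rewrite -(vsN t) /entry_sum big_ord1.
have Rsum : entry_sum R = N := sumE _ _ _ sum_Rs RE.
have Csum : entry_sum C = N := sumE _ _ _ sum_Cs CE.
have CsK t j : (Cs t ord0 j <= colsum K ord0 j)%N by rewrite mxE.
have CK j : (C ord0 j <= colsum K ord0 j)%N.
  rewrite -(ler_nat F) CE -(avg (colsum K ord0 j)%:R).
  by apply: ler_sum => t _; rewrite ler_wpM2l // ler_nat.
pose V t := margins K (Rs t) (Cs t); pose V0 := margins K R C.
have VE l : (V0 l)%:R = \sum_t alpha t * (V t l)%:R :> F.
  rewrite /V0 /V; case: l => [i|j] /=; first exact: RE.
  have slackE (C' : 'rV[nat]_n) : (C' ord0 j <= colsum K ord0 j)%N ->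
      (slack K C' ord0 j)%:R = (colsum K ord0 j)%:R - (C' ord0 j)%:R :> F.
    by move=> C'K; rewrite [slack _ _ _ _]mxE natrB.
  rewrite slackE // CE -[X in X - _]avg -sumrB; apply: eq_bigr => t _.
  by rewrite slackE // mulrBr.
(* The cell coordinates are overwritten by the integration; the value [0] lies in the domain and is
   preserved by averaging. *)
pose pt (v : 'I_m + 'I_n -> nat) (w : ('I_m + 'I_n) + 'I_m * 'I_n) : F :=
  if w is inl l then (v l)%:R else 0.
have pt_dom v : dom (@cell_coords 'I_m 'I_n) (pt v).
  by move=> [l|e] // _; rewrite /= lexx ler01.
pose Kf := cap_ffun K; pose cs := @cells 'I_m 'I_n.
pose Phi := iint cs (capacity Kf) : _ -> F.
pose kappa : F := \prod_e (Kf e).+1%:R.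
have kappa0 : 0 < kappa by apply: prodr_gt0 => e _; rewrite ltr0n.
have WK0 : 0 < weight F Kf by exact: weight_gt0.
have ntE (R' : 'rV[nat]_m) (C' : 'rV[nat]_n) : (forall j, (C' ord0 j <= colsum K ord0 j)%N) ->
    (ntables K R' C')%:R =
    kappa * iint cs (tabfun Kf (entry_sum K) (margins K R' C')) (pt (margins K R' C')).
  move=> C'K; rewrite (ntablesE _ C'K).
  have [-> _] := iint_tabfun Kf (entry_sum K) (margins K R' C') (pt (margins K R' C')).
  by rewrite mulrC divfK // gt_eqF.
have upper t : (ntables K (Rs t) (Cs t))%:R
    / Num.min (Omega F (Rs t) * Omega F (slack K (Cs t))) (Omega F K) <=
    kappa / weight F Kf * Phi (pt (V t)).
  rewrite ntE // -weight_margins -weight_cap -!mulrA ler_wpM2l ?(ltW kappa0) //.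
  rewrite [leRHS]mulrC; apply: tables_upper => //.
  - exact: cap_ffun_le.
  - by apply: margins_sum => //; rewrite sum_Rs sum_Cs.
have lower : kappa / weight F Kf * Phi (pt V0) <=
    omega F (entry_sum K) * (ntables K R C)%:R / (Omega F R * Omega F (slack K C) * Omega F K).
  have V0sum : (\sum_l V0 l = \sum_e Kf e)%N by apply: margins_sum => //; rewrite Rsum Csum.
  pose x := iint cs (tabfun Kf (entry_sum K) V0) (pt V0).
  have OV0 : 0 < Omega F R * Omega F (slack K C) by rewrite -weight_margins weight_gt0.
  have OK0 : 0 < Omega F K by rewrite -weight_cap.
  have low : Phi (pt V0) <= omega F (entry_sum K) * x / (Omega F R * Omega F (slack K C)).
    rewrite -weight_margins -cap_ffun_sum.
    by apply: tables_lower => //; exact: cap_ffun_le.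
  have -> : (ntables K R C)%:R = kappa * x := ntE _ _ CK.
  rewrite weight_cap; rewrite -(ler_pM2l (divr_gt0 kappa0 OK0)) in low.
  apply: le_trans low _; apply: eq_leW.
  by field; rewrite gt_eqF //= andbC -negb_or -mulf_eq0 gt_eqF.
apply: le_trans lower.
have capl := logconcave_iint cs (@logconcave_capacity F _ _ Kf).
have [_ jensen] := logconcave_jensen capl alpha_ge0 alpha_sum1 (fun t => pt_dom (V t)).
have ptE : pt V0 = fun w => \sum_t alpha t * pt (V t) w.
  apply/funext => -[l|e] /=; first exact: VE.
  by rewrite big1 // => t _; rewrite mulr0.
have c0 : 0 < kappa / weight F Kf by rewrite divr_gt0.
(* The same constant occurs in all [p] upper bounds; as the exponents sum to [1], it comes out
   exactly once, as in [lower]. *)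
have powc : \prod_t (kappa / weight F Kf) `^ alpha t = kappa / weight F Kf.
  rewrite -[RHS]powRr1 ?(ltW c0) // -[X in _ = _ `^ X]alpha_sum1.
  rewrite (big_morph (powR _) (id1 := 1) (op1 := *%R)) // ?powRr0 // => x y.
  by rewrite powRD // (gt_eqF c0) implybT.
have Phi0 t : 0 <= Phi (pt (V t)).
  by have [H _] := capl; have /andP[] := H _ (pt_dom (V t)).
apply: (@le_trans _ _ (\prod_t (kappa / weight F Kf * Phi (pt (V t))) `^ alpha t)).
  apply: ler_prod => t _; rewrite powR_ge0 /= ge0_ler_powR // ?nnegrE.
  - by rewrite divr_ge0 ?ler0n // le_min -weight_margins -weight_cap !ltW ?weight_gt0.
  - by rewrite mulr_ge0 ?(ltW c0).
rewrite (eq_bigr _ (fun t _ => powRM (alpha t) (ltW c0) (Phi0 t))) big_split /= powc.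
by rewrite ler_wpM2l ?(ltW c0) // ptE.
Qed.
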